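(* The fully optimal spanning trees $\alpha(\vec G)$ of ordered bipolar digraphs satisfy the following inductive definition. Let $\vec G$ be an ordered digraph on edge set $E$, bipolar w.r.t. $p=\min(E)$, and let $\omega=\max(E)$. If $|E|=1$ then $\alpha(\vec G)=\{\omega\}$. If $|E|>1$ then: (a) If $\vec G/\omega$ is bipolar w.r.t. $p$ but not $\vec G\backslash\omega$, then $\alpha(\vec G)=\alpha(\vec G/\omega)\cup\{\omega\}$. (b) If $\vec G\backslash\omega$ is bipolar w.r.t. $p$ but not $\vec G/\omega$, then $\alpha(\vec G)=\alpha(\vec G\backslash\omega)$. (c) If both $\vec G\backslash\omega$ and $\vec G/\omega$ are bipolar w.r.t. $p$, then: let $T'=\alpha(\vec G\backslash\omega)$, $C=C_G(T';\omega)$ and $e=\min(C)$; if $e$ and $\omega$ have opposite directions in $C$ then $\alpha(\vec G)=\alpha(\vec G\backslash\omega)$; if $e$ and $\omega$ have the same directions in $C$ then $\alpha(\vec G)=\alpha(\vec G/\omega)\cup\{\omega\}$. Or, equivalently to (c): let $T''=\alpha(\vec G/\omega)$, $D=C^*_G(T''\cup\{\omega\};\omega)$ and $e=\min(D)$; if $e$ and $\omega$ have opposite directions in $D$ then $\alpha(\vec G)=\alpha(\vec G/\omega)\cup\{\omega\}$; if $e$ and $\omega$ have the same directions in $D$ then $\alpha(\vec G)=\alpha(\vec G\backslash\omega)$. (These cases are exhaustive, so this determines $\alpha$ on all ordered bipolar digraphs.)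
   Context: Graphs are finite and may have loops and multiple edges. An ordered digraph $\vec G$ is a digraph with linearly ordered edge set $E$, $G$ is its underlying graph; minors inherit the order. $\vec G\backslash\omega$ and $\vec G/\omega$ denote deletion and contraction of the edge $\omega$. Cycles and cocycles (inclusion-minimal non-empty edge cuts) are edge subsets. A cocycle is directed if all its edges go from one side of the cut to the other. $\vec G$ is bipolar w.r.t. $p\in E$ if it is acyclic with a unique source and a unique sink, which are the extremities of $p$ (equivalently: every edge is in a directed cocycle and every directed cocycle contains $p$); in particular a single isthmus $p$ is bipolar. For a spanning tree $T$ of $G$, $b\in T$ and $e\notin T$: $C^*_G(T;b)=C^*(T;b)$ is the unique cocycle contained in $(E\setminus T)\cup\{b\}$ and $C_G(T;e)=C(T;e)$ the unique cycle contained in $T\cup\{e\}$. Two edges of a cycle have the same (opposite) directions in it if they are oriented the same way (opposite ways) along it; two edges of a cocycle have the same (opposite) directions in it if they cross the cut in the same (opposite) way. If $\vec G$ is bipolar w.r.t. $p=\min(E)$, its fully optimal spanning tree $\alpha(\vec G)$ is the unique spanning tree $T$ (existence and uniqueness is a known theorem) such that for all $b\in T\setminus\{p\}$, $b$ and $\min C^*(T;b)$ have opposite directions in $C^*(T;b)$, and for all $e\in E\setminus T$, $e$ and $\min C(T;e)$ have opposite directions in $C(T;e)$. *)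

(* Defs.v *)
From HB Require Import structures.
From mathcomp Require Import all_boot all_order.

Set Implicit Arguments.
Unset Strict Implicit.
Unset Printing Implicit Defensive.

(* Vertices and edges are finite subsets of ambient finite types, so that all
   minors of a digraph live in the same types [V] and [E].  The linear order on
   the edges is that of [E], and is therefore inherited by the minors.  The
   values of [etail] and [ehead] outside [edges] are irrelevant. *)
Record digraph (V E : finType) := Digraph {
  verts : {set V};
  edges : {set E};
  etail : E -> V;
  ehead : E -> V;
  ends_in_verts :
    forall e, e \in edges -> (etail e \in verts) && (ehead e \in verts)
}.

Section Minors.
Variables (V E : finType).
Implicit Types (G : digraph V E) (w : E).

Lemma deletion_ends G w e : e \in edges G :\ w ->
  (etail G e \in verts G) && (ehead G e \in verts G).
Proof. by move=> /setD1P[_]; apply: ends_in_verts. Qed.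

Definition deletion G w : digraph V E := Digraph (@deletion_ends G w).

(* The head of [w] is identified with its tail; in particular, contracting a
   loop amounts to deleting it. *)
Definition merge G w (v : V) : V := if v == ehead G w then etail G w else v.

Lemma contraction_ends G w e : e \in edges G :\ w ->
  (merge G w (etail G e) \in [set merge G w v | v in verts G]) &&
  (merge G w (ehead G e) \in [set merge G w v | v in verts G]).
Proof.
by move=> /setD1P[_ /ends_in_verts/andP[te he]]; rewrite !imset_f.
Qed.

Definition contraction G w : digraph V E := Digraph (@contraction_ends G w).

End Minors.

Section Cycles.
Variables (V E : finType) (G : digraph V E).
Implicit Types (d : E * bool) (C T : {set E}) (e f : E) (u v : V).

(* A dart is an edge with a direction of traversal: [(e, true)] goes from the
   tail of [e] to its head, [(e, false)] from the head to the tail. *)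
Definition dart_src d := if d.2 then etail G d.1 else ehead G d.1.
Definition dart_dst d := if d.2 then ehead G d.1 else etail G d.1.

(* [c] is a closed walk with edge set [C] that repeats neither a vertex nor an
   edge.  Distinctness of the edges only matters for walks of length 2, where it
   excludes going back and forth along one edge. *)
Definition traverses (c : seq (E * bool)) C : bool :=
  [&& c != [::], cycle (fun d d' => dart_dst d == dart_src d') c,
      uniq (map dart_src c), uniq (map fst c),
      [set e in map fst c] == C & C \subset edges G].

(* A traversal of [C] has exactly [#|C|] darts, so quantifying over tuples of
   that length is no restriction. *)
Definition is_cycle C : bool :=
  [exists c : #|C|.-tuple (E * bool), traverses c C].

Definition same_in_cycle C e f : bool :=
  [exists c : #|C|.-tuple (E * bool), traverses c C &&
    [exists s : bool, ((e, s) \in c) && ((f, s) \in c)]].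

Definition opposite_in_cycle C e f : bool :=
  [exists c : #|C|.-tuple (E * bool), traverses c C &&
    [exists s : bool, ((e, s) \in c) && ((f, ~~ s) \in c)]].

Definition directed_cycle C : bool :=
  [exists c : #|C|.-tuple (E * bool), traverses c C && all snd c].

Definition acyclic : bool := [forall C : {set E}, ~~ directed_cycle C].

Definition adjacent T u v : bool :=
  [exists e in T, ((etail G e == u) && (ehead G e == v)) ||
                  ((etail G e == v) && (ehead G e == u))].

Definition spanning_tree T : bool :=
  [&& T \subset edges G,
      [forall u in verts G, forall v in verts G, connect (adjacent T) u v]
    & [forall C : {set E}, is_cycle C ==> ~~ (C \subset T)]].

Definition fund_cycle T e : {set E} :=
  odflt set0 [pick C : {set E} | is_cycle C & C \subset e |: T].

End Cycles.

Section Cocycles.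
Variables (V E : finType) (G : digraph V E).
Implicit Types (S : {set V}) (D T : {set E}) (b e f : E).

Definition cut S : {set E} :=
  [set e in edges G | (etail G e \in S) != (ehead G e \in S)].

Definition nonempty_cut D : bool :=
  (D != set0) && [exists S : {set V}, (S \subset verts G) && (D == cut S)].

Definition is_cocycle D : bool := minset nonempty_cut D.

Definition same_in_cocycle D e f : bool :=
  [&& is_cocycle D, e \in D, f \in D &
    [exists S : {set V}, [&& S \subset verts G, D == cut S &
      (etail G e \in S) == (etail G f \in S)]]].

Definition opposite_in_cocycle D e f : bool :=
  [&& is_cocycle D, e \in D, f \in D &
    [exists S : {set V}, [&& S \subset verts G, D == cut S &
      (etail G e \in S) != (etail G f \in S)]]].

Definition fund_cocycle T b : {set E} :=
  odflt set0 [pick D : {set E} | is_cocycle D & D \subset b |: (edges G :\: T)].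

End Cocycles.

Section Bipolar.
Variables (V E : finType) (G : digraph V E).

Definition sources : {set V} :=
  [set v in verts G | [forall e in edges G, ehead G e != v]].
Definition sinks : {set V} :=
  [set v in verts G | [forall e in edges G, etail G e != v]].

Definition bipolar (p : E) : bool :=
  [&& p \in edges G, acyclic G &
    [exists s : V, exists t : V,
      [&& sources == [set s], sinks == [set t] &
          [set s; t] == [set etail G p; ehead G p]]]].

End Bipolar.

Section FullyOptimal.
Variables (disp : Order.disp_t) (V : finType) (E : finOrderType disp).
Implicit Types (G : digraph V E) (A T : {set E}) (m b e : E).

Definition is_min A m : bool := (m \in A) && [forall x in A, (m <= x)%O].
Definition is_max A m : bool := (m \in A) && [forall x in A, (x <= m)%O].

Definition fully_optimal G T : bool :=
  [&& spanning_tree G T,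
      [forall b in T, ~~ is_min (edges G) b ==>
        [exists m, is_min (fund_cocycle G T b) m &&
                   opposite_in_cocycle G (fund_cocycle G T b) b m]]
    & [forall e in edges G :\: T,
        [exists m, is_min (fund_cycle G T e) m &&
                   opposite_in_cycle G (fund_cycle G T e) e m]]].

(* When [G] is bipolar with respect to its smallest edge there is exactly one
   fully optimal spanning tree, so the choice made by [pick] is immaterial. *)
Definition alpha G : {set E} := odflt set0 [pick T | fully_optimal G T].

End FullyOptimal.

(* Main.v *)
Require Import Defs.
From HB Require Import structures.
From mathcomp Require Import all_boot all_order all_algebra.
From mathcomp Require Import zify ring.

(** The whole argument runs on the matrix [N] of a spanning tree [T], with rows
    indexed by [T] and columns by the other edges: row [b] is the signed
    fundamental cocycle of [b], and column [e] is, up to sign, the signed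
    fundamental cycle of [e] ([spanning_fundamental]).  Full optimality only
    says that the first nonzero entry of every column, as well as of every row
    but the row of [p], comes before the index of that line and has a given
    sign ([fully_optimalP]).

    Uniqueness is linear programming duality.  Give the edges positive weights
    that decrease so fast that each exceeds the sum of all later ones, and add
    up the fundamental cocycles of a fully optimal tree [T], weighted by their
    edges.  The leading term decides, and the result is a tension that equals
    the weight on [T] and is larger off [T].  The fundamental cycles add up in
    the same way to a flow that equals the weight off [T] and is larger on
    [T :\ p].  For two fully optimal trees, pair the excess of the flow of the
    one with the excess of the tension of the other: as flows are orthogonal to
    tensions, this pairing is a function of the first tree plus a function of
    the second ([slackE]).  It is nonnegative, and complementary slackness makes
    it vanish when both trees are the same, so it always vanishes, which forces
    the trees to be equal ([fully_optimal_unique]).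

    The same positive tension and almost positive flow show that a connected
    digraph with a fully optimal tree is bipolar ([optimal_bipolar]).

    Let [w] be the last edge.  It is never the first nonzero entry that a line
    of another edge is judged by, so a fully optimal tree of a minor at [w],
    completed by [w] in the case of the contraction, satisfies every condition
    in [G] except possibly the one for [w] itself.  Reversing [w] changes the
    sign of this last condition only: the tree is therefore fully optimal
    either in [G] or in [G] with [w] reversed ([deletion_lift],
    [contraction_lift]).  In the second case that reorientation is bipolar, and
    then both minors are.  If only one minor is bipolar, its tree is therefore
    the one of [G].  If both are, the two candidate trees differ at [w], so by
    uniqueness they cannot be optimal for the same orientation of [w]: exactly
    one is optimal in [G], and the sign condition of [w], read in a fundamental
    cycle or cocycle, tells which.  Together with [bipolar_minor] this also
    gives existence, by induction on the number of edges
    ([fully_optimal_exists]). *)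

Set Implicit Arguments.
Unset Strict Implicit.
Unset Printing Implicit Defensive.

Import Order.TTheory GRing.Theory Num.Theory.
Local Open Scope ring_scope.

(** * Flows, tensions and the matrix of a spanning tree *)
Section FlowsAndTensions.
Variables (V E : finType).
Implicit Types (G : digraph V E) (x y : E -> int) (T : {set E}).

Definition diff G (pi : V -> int) (f : E) : int :=
  pi (ehead G f) - pi (etail G f).

Definition tension G y := exists pi, {in edges G, y =1 diff G pi}.

(** Orthogonality to all tensions.  Taking for [pi] the indicator of a vertex
    gives the conservation law there; the present form makes contraction and
    duality immediate. *)
Definition flow G x := forall pi, \sum_(f in edges G) x f * diff G pi f = 0.

Lemma flow_tension G x y :
  flow G x -> tension G y -> \sum_(f in edges G) x f * y f = 0.
Proof.
move=> Fx [pi Ey]; rewrite -[RHS](Fx pi); apply: eq_bigr => f fG.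
by rewrite Ey.
Qed.

Lemma tension_sum G (A : {set E}) (c : E -> int) (Y : E -> E -> int) :
  (forall b, b \in A -> tension G (Y b)) ->
  tension G (fun f => \sum_(b in A) c b * Y b f).
Proof.
move=> tY; suff: forall r : seq E, {subset r <= A} ->
    tension G (fun f => \sum_(b <- r) c b * Y b f).
  move=> /(_ (enum A)) []; first by move=> b; rewrite mem_enum.
  by move=> pi Epi; exists pi => f fG; rewrite -Epi // big_enum.
elim=> [_|b r IHr sub].
  by exists (fun=> 0) => f _; rewrite /diff subrr big_nil.
have [|pi Epi] := IHr; first by move=> g gr; apply: sub; rewrite inE gr orbT.
have [|rho Erho] := tY b; first by apply: sub; rewrite inE eqxx.
exists (fun v => c b * rho v + pi v) => f fG.
rewrite big_cons Epi // Erho // /diff; ring.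
Qed.

Lemma flow_sum G (A : {set E}) (c : E -> int) (X : E -> E -> int) :
  (forall e, e \in A -> flow G (X e)) ->
  flow G (fun f => \sum_(e in A) c e * X e f).
Proof.
move=> fX pi; under eq_bigr do rewrite big_distrl /=.
rewrite exchange_big big1 // => e eA.
under eq_bigr do rewrite -mulrA.
by rewrite -big_distrr /= fX ?mulr0.
Qed.

Definition ind (S : {set V}) (v : V) : int := (v \in S)%:R.

(** Fundamental cocycles have coordinate 1 at their own edge of the tree and 0
    at the other ones, so that [N] only stores coordinates off the tree. *)
Definition fund_row T (N : E -> E -> int) (b f : E) : int :=
  if f \in T then (f == b)%:R else N b f.

(** The sign is the orthogonality relation between a fundamental cycle and a
    fundamental cocycle: their supports meet in at most the two edges [e] and
    [f], where the products of their coordinates cancel. *)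
Definition fund_col T (N : E -> E -> int) (e f : E) : int :=
  if f \in T then - N f e else (f == e)%:R.

Definition fundamental G T (N : E -> E -> int) :=
  [/\ T \subset edges G,
      forall b, b \in T -> tension G (fund_row T N b),
      forall e, e \in edges G :\: T -> flow G (fund_col T N e)
    & forall b e, b \in T -> e \in edges G :\: T ->
        [\/ N b e = 0, N b e = 1 | N b e = -1]].

Lemma fundamental_sub G T N : fundamental G T N -> T \subset edges G.
Proof. by case. Qed.

Lemma sum_row G T N x b : fundamental G T N -> b \in T ->
  \sum_(f in edges G) x f * fund_row T N b f =
    x b + \sum_(e in edges G :\: T) x e * N b e.
Proof.
case=> sT _ _ _ bT; rewrite (big_setID T) (setIidPr sT) /=; congr (_ + _).
  rewrite (big_setD1 b) //= /fund_row bT eqxx mulr1 big1 ?addr0 // => f.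
  by rewrite in_setD1 => /andP[/negPf-> ->]; rewrite mulr0.
by apply: eq_bigr => f; rewrite inE /fund_row => /andP[/negPf->].
Qed.

Lemma sum_col G T N y e : fundamental G T N -> e \in edges G :\: T ->
  \sum_(f in edges G) fund_col T N e f * y f =
    y e - \sum_(b in T) N b e * y b.
Proof.
case=> sT _ _ _ eT; rewrite (big_setID T) (setIidPr sT) /= addrC.
rewrite (big_setD1 e) //= big1 => [|f]; last first.
  by rewrite !inE /fund_col => /and3P[/negPf-> /negPf-> _]; rewrite mul0r.
move: (eT); rewrite inE => /andP[/negPf eT' _].
rewrite /fund_col eT' eqxx mul1r addr0 -sumrN; congr (_ + _).
by apply: eq_bigr => f ->; rewrite mulNr.
Qed.

(** The rows of [N] make a flow determined by its values off the tree, just as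
    the columns make a tension determined by its values on the tree. *)
Lemma flow_on_tree G T N x : fundamental G T N -> flow G x ->
  forall b, b \in T -> x b = - \sum_(e in edges G :\: T) x e * N b e.
Proof.
move=> FN Fx b bT; have [_ tr _ _] := FN.
have := flow_tension Fx (tr b bT); rewrite (sum_row _ FN) //; lia.
Qed.

Lemma tension_off_tree G T N y : fundamental G T N -> tension G y ->
  forall e, e \in edges G :\: T -> y e = \sum_(b in T) N b e * y b.
Proof.
move=> FN ty e eT; have [_ _ fc _] := FN.
have := flow_tension (fc e eT) ty; rewrite (sum_col _ FN) //; lia.
Qed.

End FlowsAndTensions.

(** * Closed walks *)
Section Walks.
Variables (V E : finType) (G : digraph V E).
Implicit Types (d : E * bool) (c p : seq (E * bool)) (C T : {set E}).

Local Notation src := (dart_src G).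
Local Notation dst := (dart_dst G).
Local Notation chain := (fun d d' => dart_dst G d == dart_src G d').

Definition dart_sign (s : bool) : int := if s then 1 else -1.

Lemma diff_dart pi d : pi (dst d) - pi (src d) = dart_sign d.2 * diff G pi d.1.
Proof. by case: d => e [] /=; rewrite /dart_dst /dart_src /diff /=; lia. Qed.

Lemma sum_chain (pi : V -> int) d p : path chain d p ->
  \sum_(d' <- p) (pi (dst d') - pi (src d')) = pi (dst (last d p)) - pi (dst d).
Proof.
elim: p d => [|d' p IHp] d /=; first by rewrite big_nil subrr.
by move=> /andP[/eqP Ed /IHp IH]; rewrite big_cons IH -Ed; ring.
Qed.

Lemma sum_cycle (pi : V -> int) c : cycle chain c ->
  \sum_(d <- c) (pi (dst d) - pi (src d)) = 0.
Proof.
case: c => [|d c] /=; first by rewrite big_nil.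
move=> /(sum_chain pi); rewrite last_rcons subrr => sum0.
rewrite -[RHS]sum0; by rewrite -cats1 big_cat big_seq1 big_cons /= addrC.
Qed.

(** The signed incidence vector of a walk.  On a traversal of a cycle it takes
    the value 1 or -1 according to the direction in which an edge is used, so
    that directions in cycles become signs of a flow. *)
Definition walk_vector c (f : E) : int :=
  \sum_(d <- c) dart_sign d.2 * (d.1 == f)%:R.

Lemma walk_vector_notin c f : f \notin map fst c -> walk_vector c f = 0.
Proof.
move=> fc; rewrite /walk_vector big_seq big1 // => d dc.
case: eqP => [Ed|]; last by rewrite mulr0.
by case/negP: fc; rewrite -Ed map_f.
Qed.

Lemma walk_vector_in c f s : uniq (map fst c) -> (f, s) \in c ->
  walk_vector c f = dart_sign s.
Proof.
rewrite /walk_vector; elim: c => //= d c IHc /andP[dc uc].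
rewrite inE big_cons => /orP[/eqP Ed|fc].
  rewrite -Ed eqxx mulr1 /= -/(walk_vector c f).
  by rewrite walk_vector_notin ?addr0 //; move: dc; rewrite -Ed.
rewrite IHc //; case: eqP => [Ed|]; last by rewrite mulr0 add0r.
by case/negP: dc; rewrite Ed; apply/mapP; exists (f, s).
Qed.

Lemma walk_flow c C : traverses G c C -> flow G (walk_vector c).
Proof.
case/and5P => _ cc _ _ /andP[/eqP EC CG] pi.
transitivity (\sum_(d <- c) (pi (dst d) - pi (src d))); last exact: sum_cycle.
under eq_bigr do rewrite big_distrl /=.
rewrite exchange_big /= big_seq [RHS]big_seq; apply: eq_bigr => d dc.
have dG : d.1 \in edges G.
  by apply: (subsetP CG); rewrite -EC inE map_f.
rewrite (big_setD1 d.1) //= eqxx mulr1 diff_dart big1 ?addr0 // => f.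
by rewrite in_setD1 eq_sym => /andP[/negPf->]; rewrite mulr0 mul0r.
Qed.

Lemma traverses_mem c C f : traverses G c C -> (f \in C) = (f \in map fst c).
Proof. by case/and5P=> _ _ _ _ /andP[/eqP <- _]; rewrite inE. Qed.

Lemma traverses_uniq c C : traverses G c C -> uniq (map fst c).
Proof. by case/and5P. Qed.

Lemma traverses_size c C : traverses G c C -> size c == #|C|.
Proof.
case/and5P => _ _ _ uc /andP[/eqP <- _].
by rewrite cardsE (card_uniqP uc) size_map.
Qed.

(** Frees the cycle predicates of their length-indexed tuples. *)
Lemma traverses_tuple (P : seq (E * bool) -> bool) C :
  reflect (exists2 c, traverses G c C & P c)
    [exists c : #|C|.-tuple (E * bool), traverses G c C && P c].
Proof.
apply: (iffP existsP) => [[c /andP[tc Pc]]|[c tc Pc]]; first by exists c.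
by exists (Tuple (traverses_size tc)); rewrite tc.
Qed.

Lemma cycleP C : reflect (exists c, traverses G c C) (is_cycle G C).
Proof.
apply: (iffP existsP) => [[c tc]|[c tc]]; first by exists c.
by exists (Tuple (traverses_size tc)).
Qed.

Lemma walk_vector0 c C f : traverses G c C ->
  (f \in C) = (walk_vector c f != 0).
Proof.
move=> tc; rewrite (traverses_mem _ tc).
case: (boolP (f \in _)) => fc; last by rewrite walk_vector_notin.
move: fc => /mapP[[f' s] fc /= ->].
by rewrite (walk_vector_in (traverses_uniq tc) fc); case: s {fc}.
Qed.

Lemma walk_vector_sign c C f s : traverses G c C ->
  ((f, s) \in c) = (walk_vector c f == dart_sign s).
Proof.
move=> tc; have uc := traverses_uniq tc.
apply/idP/eqP => [|Ef]; first exact: walk_vector_in.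
have : f \in map fst c.
  by rewrite -(traverses_mem _ tc) (walk_vector0 _ tc) Ef; case: s {Ef}.
move=> /mapP[[f' s'] fc /= Ef']; rewrite -Ef' in fc.
by move: Ef; rewrite (walk_vector_in uc fc); case: s s' fc => [] [].
Qed.

Lemma chain_src d p : path chain d p ->
  map src p = belast (dst d) (map dst p).
Proof. by elim: p d => //= d' p IHp d /andP[/eqP-> /IHp->]. Qed.

(** If the first edge came back, both its ends, and among them the starting
    vertex of the walk, would be visited again. *)
Lemma chain_uniq_edges d p : path chain d p -> uniq (dst d :: map dst p) ->
  uniq (map fst p).
Proof.
elim: p d => //= d' p IHp d /andP[/eqP Ed pp].
rewrite inE negb_or => /andP[/andP[_ dp] up]; rewrite (IHp _ pp up) andbT.
apply/negP => /mapP[d2 d2p Efst].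
have: dst d \in dst d' :: map dst p; last first.
  rewrite inE (negPf dp) orbF => /eqP Edd.
  have /mem_belast : src d2 \in belast (dst d') (map dst p).
    by rewrite -(chain_src pp) map_f.
  have := map_f dst d2p; move: up dp.
  case: d' d2 d2p Efst Ed Edd {IHp pp} => [e s] [e' s'] /= _ ->.
  rewrite /dart_dst /dart_src /=.
  by case: s s' => [] [] /= Ed Edd; rewrite -?Ed -?Edd ?Ed; case: (_ \in _).
have: src d2 \in dst d' :: map dst p.
  by apply: mem_belast; rewrite -(chain_src pp) map_f.
have: dst d2 \in dst d' :: map dst p by rewrite inE map_f ?orbT.
case: d' d2 d2p Efst Ed {up dp IHp pp} => [e s] [e' s'] /= _ ->.
by rewrite /dart_dst /dart_src /=; case: s s' => [] [] /= ->.
Qed.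

(** The closing dart [d] comes first, so that the vertices visited afterwards
    form a simple path from its end to its origin. *)
Lemma traverses_closed_chain d p :
  path chain d p -> dst (last d p) = src d -> uniq (dst d :: map dst p) ->
  d.1 \notin map fst p -> all (fun d' => d'.1 \in edges G) (d :: p) ->
  traverses G (d :: p) [set e in map fst (d :: p)].
Proof.
move=> pp Elast up dp allG; apply/and5P; split=> //.
- by rewrite /= rcons_path pp Elast eqxx.
- rewrite /= (chain_src pp) -Elast -(last_map dst).
  by move: up; rewrite lastI rcons_uniq.
- by rewrite /= dp (chain_uniq_edges pp up).
- rewrite eqxx; apply/subsetP => e; rewrite inE => /mapP[d' d'p ->].
  exact: (allP allG).
Qed.

(** The single source of cycles below: undirected ones close a path in a tree,
    directed ones close a path of forward darts. *)
Lemma connect_chain (r : rel V) (P : pred (E * bool)) d u :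
  (forall v v', r v v' -> exists d', [/\ P d', src d' = v & dst d' = v']) ->
  connect r (dst d) u ->
  exists p, [/\ path chain d p, dst (last d p) = u,
    uniq (dst d :: map dst p) & all P p].
Proof.
move=> rP /connectP[q0 /shortenP[q rq uq _] ->] {q0}.
suff [p [pp Eq Pp]] : exists p, [/\ path chain d p, map dst p = q & all P p].
  by exists p; rewrite -(last_map dst) Eq.
elim: q d rq {uq} => [|v q IHq] d /=; first by exists [::].
move=> /andP[/rP[d' [Pd' Ed <-]]] /IHq[p [pp <- Pp]].
by exists (d' :: p) => /=; rewrite pp Ed eqxx Pd'.
Qed.

End Walks.

(** * Spanning trees and fundamental cycles and cocycles *)
Section Trees.
Variables (V E : finType) (G : digraph V E).
Implicit Types (T A B C D : {set E}) (N : E -> E -> int) (b e f : E).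

Lemma opposite_in_cycleP C e f :
  reflect (exists2 c, traverses G c C &
             [exists s : bool, ((e, s) \in c) && ((f, ~~ s) \in c)])
    (opposite_in_cycle G C e f).
Proof. exact: traverses_tuple. Qed.

Lemma same_in_cycleP C e f :
  reflect (exists2 c, traverses G c C &
             [exists s : bool, ((e, s) \in c) && ((f, s) \in c)])
    (same_in_cycle G C e f).
Proof. exact: (traverses_tuple _ (fun c => _)). Qed.

(** Connectivity in dual form: no cut avoids [A] and separates two vertices.
    This is what pairing with flows can establish. *)
Definition connected_by A := forall S : {set V},
  (forall f, f \in A -> (etail G f \in S) = (ehead G f \in S)) ->
  forall u v, u \in verts G -> v \in verts G -> u \in S -> v \in S.

Lemma connected_byS A B : A \subset B -> connected_by A -> connected_by B.
Proof. by move=> sAB cA S SB; apply: cA => f /(subsetP sAB)/SB. Qed.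

Lemma adjacent_sym A : connect_sym (adjacent G A).
Proof.
apply: sym_connect_sym => u v; rewrite /adjacent.
by apply: eq_existsb => e; rewrite orbC.
Qed.

Lemma adjacent_edge A f : f \in A -> adjacent G A (etail G f) (ehead G f).
Proof. by move=> fA; apply/existsP; exists f; rewrite fA !eqxx. Qed.

Lemma connected_connect A u v : connected_by A ->
  u \in verts G -> v \in verts G -> connect (adjacent G A) u v.
Proof.
move=> cA uG vG; have := cA [set x | connect (adjacent G A) u x].
move=> /(_ _ u v uG vG); rewrite !inE connect0; apply=> // f fA.
have af := connect1 (adjacent_edge fA); rewrite !inE.
apply/idP/idP => h; apply: connect_trans h _ => //.
by rewrite adjacent_sym.
Qed.

Lemma spanning_sub T : spanning_tree G T -> T \subset edges G.
Proof. by case/and3P. Qed.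

Lemma spanning_connect T u v : spanning_tree G T ->
  u \in verts G -> v \in verts G -> connect (adjacent G T) u v.
Proof.
by case/and3P => _ /forall_inP cT _ uG vG; have /forall_inP/(_ v vG) := cT u uG.
Qed.

Lemma spanning_connected T : spanning_tree G T -> connected_by T.
Proof.
move=> tT S ST u v uG vG uS.
have clS : closed (adjacent G T) (mem S).
  move=> x y /existsP[f /andP[fT /orP[]/andP[/eqP<- /eqP<-]]];
  by rewrite /= ?(ST f fT) // -(ST f fT).
by rewrite -(closed_connect clS (spanning_connect tT uG vG)).
Qed.

Lemma path_cycle T e : T \subset edges G -> e \in edges G -> e \notin T ->
  connect (adjacent G T) (ehead G e) (etail G e) ->
  exists c C, [/\ traverses G c C, C \subset e |: T & (e, true) \in c].
Proof.
move=> sT eG eT ce.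
have [|p [pp Ep up Tp]] := @connect_chain _ _ G (adjacent G T)
  (fun d => d.1 \in T) (e, true) (etail G e) _ ce.
  move=> v v' /existsP[f /andP[fT /orP[]/andP[/eqP<- /eqP<-]]].
    by exists (f, true).
  by exists (f, false).
exists ((e, true) :: p), [set f in map fst ((e, true) :: p)]; split.
- apply: traverses_closed_chain => //=.
    by apply: contra eT => /mapP[d dp ->]; apply: (allP Tp).
  by rewrite eG /=; apply/allP => d dp; apply: (subsetP sT); apply: (allP Tp).
- apply/subsetP => f; rewrite !inE /= => /orP[->//|/mapP[d dp ->]].
  by rewrite (allP Tp d dp) orbT.
- by rewrite inE eqxx.
Qed.

(** The side of the fundamental cocycle of [b] that contains the head of [b]. *)
Definition side T b : {set V} :=
  [set x | connect (adjacent G (T :\ b)) (ehead G b) x].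

Lemma diff_ind_side T b f : spanning_tree G T -> b \in T -> f \in T ->
  diff G (ind (side T b)) f = (f == b)%:R.
Proof.
case/and3P => sT _ /forallP/=acT bT fT.
rewrite /diff /ind !inE; case: eqP => [->|/eqP neq].
  rewrite connect0; case: (boolP (connect _ _ _)) => //= cb.
  have sT' : T :\ b \subset edges G by apply: subset_trans sT; apply: subsetDl.
  have [|c [C [tc sC _]]] := path_cycle sT' (subsetP sT b bT) _ cb.
    by rewrite !inE eqxx.
  have cC : is_cycle G C by apply/cycleP; exists c.
  by case/negP: (implyP (acT C) cC); rewrite -(setD1K bT).
have fT' : f \in T :\ b by rewrite !inE neq.
have af := connect1 (adjacent_edge fT').
suff -> : connect (adjacent G (T :\ b)) (ehead G b) (ehead G f) =
          connect (adjacent G (T :\ b)) (ehead G b) (etail G f).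
  by rewrite subrr.
apply/idP/idP => h; apply: connect_trans h _ => //.
by rewrite adjacent_sym.
Qed.

(** The row of [b] is the coboundary of one side of its fundamental cocycle.
    That its entries also describe the fundamental cycles follows from the
    orthogonality of these to the cocycles. *)
Lemma spanning_fundamental T : spanning_tree G T ->
  exists N, fundamental G T N.
Proof.
move=> tT; exists (fun b => diff G (ind (side T b))).
have sT := spanning_sub tT.
split=> [//|b bT|e|b e _ _].
- exists (ind (side T b)) => f _; rewrite /fund_row; case: (boolP (f \in T)) => // fT.
  by rewrite diff_ind_side.
- rewrite inE => /andP[eT eG].
  have /andP[teG heG] := ends_in_verts eG.
  have [c [C [tc sC ec]]] := path_cycle sT eG eT (spanning_connect tT heG teG).
  have xe : walk_vector c e = 1 by rewrite (walk_vector_in (traverses_uniq tc) ec).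
  have x0 f : f != e -> f \notin T -> walk_vector c f = 0.
    move=> fe fT; apply: walk_vector_notin; rewrite -(traverses_mem _ tc).
    by apply: contra fT => /(subsetP sC); rewrite !inE (negPf fe).
  suff Ex : {in edges G,
      fund_col T (fun b => diff G (ind (side T b))) e =1 walk_vector c}.
    move=> pi; rewrite -[RHS](walk_flow tc pi).
    by apply: eq_bigr => f /Ex->.
  move=> f fG; rewrite /fund_col; case: ifPn => fT; last first.
    by case: eqP => [->|/eqP fe]; rewrite ?xe ?x0.
  have := walk_flow tc (ind (side T f)).
  have fe : f != e by apply: contraNneq eT => <-.
  rewrite (big_setD1 f) //= (big_setD1 e) /=; last by rewrite !inE eq_sym fe.
  rewrite big1 => [|g].
    rewrite diff_ind_side // eqxx xe mulr1 mul1r addr0.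
    by move/eqP; rewrite addr_eq0 => /eqP->.
  rewrite !inE => /and3P[ge gf gG]; case: (boolP (g \in T)) => gT.
    by rewrite diff_ind_side // (negPf gf) mulr0.
  by rewrite x0 ?mul0r.
rewrite /diff /ind; case: (_ \in _); case: (_ \in _);
  by [constructor 1|constructor 2|constructor 3].
Qed.

Lemma ind_tension (S : {set V}) : tension G (diff G (ind S)).
Proof. by exists (ind S). Qed.

Lemma diff_ind0 (S : {set V}) f :
  reflect (diff G (ind S) f = 0) ((etail G f \in S) == (ehead G f \in S)).
Proof.
by rewrite /diff /ind; case: (_ \in _); case: (_ \in _); constructor.
Qed.

(** A cut that avoids [T] is a tension that vanishes on [T], hence everywhere. *)
Lemma fundamental_connected T N :
  connected_by (edges G) -> fundamental G T N -> connected_by T.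
Proof.
move=> cG FN S ST; apply: cG => f fG; apply/eqP/diff_ind0.
case: (boolP (f \in T)) => fT; first by apply/diff_ind0/eqP/ST.
rewrite (tension_off_tree FN (ind_tension S)) ?inE ?fT //.
rewrite big1 // => b bT; have /eqP/diff_ind0-> := ST b bT; exact: mulr0.
Qed.

(** The flow of a cycle inside [T] would vanish off [T], hence everywhere. *)
Lemma cycle_not_in_tree T N C : fundamental G T N -> is_cycle G C ->
  ~~ (C \subset T).
Proof.
move=> FN /cycleP[c tc]; apply/negP => sC.
have [b [s bc]] : exists b s, (b, s) \in c.
  by case/and5P: tc; case: c => // -[b s] c _ _ _ _; exists b, s; rewrite inE eqxx.
have bT : b \in T.
  by apply: (subsetP sC); rewrite (traverses_mem _ tc); apply/mapP; exists (b, s).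
have := flow_on_tree FN (walk_flow tc) bT.
rewrite (walk_vector_in (traverses_uniq tc) bc) big1 ?oppr0; first by case: s {bc}.
move=> g; rewrite inE => /andP[gT gG]; rewrite walk_vector_notin ?mul0r //.
by rewrite -(traverses_mem _ tc); apply: contra gT; apply: (subsetP sC).
Qed.

Lemma fundamental_spanning T N :
  connected_by (edges G) -> fundamental G T N -> spanning_tree G T.
Proof.
move=> cG FN; apply/and3P; split; first exact: fundamental_sub FN.
  apply/forall_inP => u uG; apply/forall_inP => v vG.
  exact: connected_connect (fundamental_connected cG FN) uG vG.
by apply/forallP => C; apply/implyP => /(cycle_not_in_tree FN).
Qed.

Section FundamentalCycle.
Variables (T : {set E}) (N : E -> E -> int) (e : E).
Hypotheses (tT : spanning_tree G T) (FN : fundamental G T N)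
  (eT : e \in edges G :\: T).

Lemma fund_cycle_spec : is_cycle G (fund_cycle G T e) &&
  (fund_cycle G T e \subset e |: T).
Proof.
move: eT; rewrite inE => /andP[eT' eG].
have sT := spanning_sub tT.
have /andP[teG heG] := ends_in_verts eG.
have [c [C [tc sC _]]] := path_cycle sT eG eT' (spanning_connect tT heG teG).
rewrite /fund_cycle; case: pickP => [//|/(_ C)/negP[]].
by rewrite sC andbT; apply/cycleP; exists c.
Qed.

(** Up to a global sign, the vector of any traversal of the fundamental cycle is
    the column of [e]. *)
Lemma fund_cycle_walk c : traverses G c (fund_cycle G T e) ->
  exists2 s, (e, s) \in c &
    forall f, f \in T -> walk_vector c f = - dart_sign s * N f e.
Proof.
move=> tc; have /andP[cC sC] := fund_cycle_spec.
have eC : e \in fund_cycle G T e.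
  apply/negPn/negP => eC; case/negP: (cycle_not_in_tree FN cC).
  apply/subsetP => f fC; move: (subsetP sC f fC); rewrite !inE.
  by case: eqP => // Ef; case/negP: eC; rewrite -[X in X \in _]Ef.
move: (eC); rewrite (traverses_mem _ tc) => /mapP[[e' s] ec /= Ee].
rewrite -Ee in ec; exists s => // f fT.
rewrite (flow_on_tree FN (walk_flow tc) fT) (big_setD1 e) //= big1 ?addr0.
  by rewrite (walk_vector_in (traverses_uniq tc) ec) mulNr.
move=> g; rewrite !inE => /and3P[ge gT gG].
rewrite walk_vector_notin ?mul0r // -(traverses_mem _ tc).
by apply: contra gT => /(subsetP sC); rewrite !inE (negPf ge).
Qed.

Lemma mem_fund_cycle f :
  (f \in fund_cycle G T e) = (f == e) || ((f \in T) && (N f e != 0)).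
Proof.
have /andP[/cycleP[c tc] sC] := fund_cycle_spec.
have [s ec walkT] := fund_cycle_walk tc.
case: eqP => [->|/eqP fe] /=.
  by rewrite (traverses_mem _ tc); apply/mapP; exists (e, s).
case: (boolP (f \in T)) => fT /=; last first.
  by apply: contraNF fT => /(subsetP sC); rewrite !inE (negPf fe).
by rewrite (walk_vector0 _ tc) walkT // mulf_eq0; case: (s).
Qed.

(** Common treatment of same ([r = false]) and opposite ([r = true])
    directions. *)
Lemma fund_cycle_sign (r : bool) c f : traverses G c (fund_cycle G T e) ->
  f != e ->
  [exists s : bool, ((e, s) \in c) && ((f, r (+) s) \in c)] =
  (f \in T) && (N f e == dart_sign r).
Proof.
move=> tc fe; have [s ec walkT] := fund_cycle_walk tc.
have xe : walk_vector c e = dart_sign s.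
  by rewrite -(walk_vector_in (traverses_uniq tc) ec).
apply/existsP/andP => [[s' /andP[]]|[fT /eqP Nf]].
  rewrite (walk_vector_sign _ _ tc) xe => Es fc.
  have fT : f \in T.
    have : f \in fund_cycle G T e.
      by rewrite (traverses_mem _ tc); apply/mapP; exists (f, r (+) s').
    by rewrite mem_fund_cycle (negPf fe) => /andP[].
  split=> //; move: fc Es; rewrite (walk_vector_sign _ _ tc) walkT //.
  by move: (N f e) => n; clear; case: r s s' => [] [] [] /= /eqP; lia.
exists s; rewrite ec (walk_vector_sign _ _ tc) walkT // Nf.
by case: r s {Nf ec xe walkT} => [] [].
Qed.

Lemma opposite_fund_cycle f :
  opposite_in_cycle G (fund_cycle G T e) e f = (f \in T) && (N f e == 1).
Proof.
have eT' : e \notin T by case/setDP: eT.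
have /andP[/cycleP[c0 tc0] _] := fund_cycle_spec.
have [->|fe] := eqVneq f e.
  rewrite (negPf eT'); apply/negbTE/opposite_in_cycleP => -[c tc /existsP[s /andP[]]].
  by rewrite !(walk_vector_sign _ _ tc) => /eqP->; case: s.
apply/opposite_in_cycleP/idP => [[c tc]|NT]; last exists c0 => //.
  by have /= <- := fund_cycle_sign true tc fe.
by have /= -> := fund_cycle_sign true tc0 fe.
Qed.

Lemma same_fund_cycle f : f != e ->
  same_in_cycle G (fund_cycle G T e) e f = (f \in T) && (N f e == -1).
Proof.
have /andP[/cycleP[c0 tc0] _] := fund_cycle_spec => fe.
apply/same_in_cycleP/idP => [[c tc]|NT]; last exists c0 => //.
  by have /= <- := fund_cycle_sign false tc fe.
by have /= -> := fund_cycle_sign false tc0 fe.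
Qed.

End FundamentalCycle.

Lemma opposite_in_cycleC C e f :
  opposite_in_cycle G C e f = opposite_in_cycle G C f e.
Proof.
suff imp e' f' : opposite_in_cycle G C e' f' -> opposite_in_cycle G C f' e'.
  by apply/idP/idP; apply: imp.
case/opposite_in_cycleP => c tc /existsP[s /andP[es fs]].
apply/opposite_in_cycleP; exists c => //; apply/existsP; exists (~~ s).
by rewrite fs negbK.
Qed.

Lemma same_in_cycleC C e f : same_in_cycle G C e f = same_in_cycle G C f e.
Proof.
by apply: eq_existsb => c; congr (_ && _); apply: eq_existsb => s; rewrite andbC.
Qed.

Lemma mem_cut (S : {set V}) f :
  (f \in cut G S) = (f \in edges G) && (diff G (ind S) f != 0).
Proof. by rewrite inE; congr (_ && ~~ _); apply/idP/eqP => /diff_ind0. Qed.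

Lemma cut_verts (S : {set V}) : cut G (S :&: verts G) = cut G S.
Proof.
apply/setP => f; rewrite !inE; case: (boolP (f \in _)) => //= fG.
by have /andP[-> ->] := ends_in_verts fG; rewrite !andbT.
Qed.

Section FundamentalCocycle.
Variables (T : {set E}) (N : E -> E -> int) (b : E).
Hypotheses (tT : spanning_tree G T) (FN : fundamental G T N) (bT : b \in T).

Lemma fund_cocycle_spec : is_cocycle G (fund_cocycle G T b) &&
  (fund_cocycle G T b \subset b |: (edges G :\: T)).
Proof.
have bG := subsetP (spanning_sub tT) b bT.
pose D := cut G (side T b).
have [D' /andP[minD' sD']] : exists D', minset (nonempty_cut G) D' && (D' \subset D).
  suff /minset_exists[D' mD' sD'] : nonempty_cut G D by exists D'; rewrite mD'.
  apply/andP; split.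
    by apply/set0Pn; exists b; rewrite mem_cut bG diff_ind_side // eqxx.
  by apply/existsP; exists (side T b :&: verts G); rewrite cut_verts subsetIr /=.
rewrite /fund_cocycle; case: pickP => [//|/(_ D')/negP[]].
rewrite /is_cocycle minD'; apply: subset_trans sD' _; apply/subsetP => f.
rewrite mem_cut !inE => /andP[->]; rewrite andbT.
case: (boolP (f \in T)) => fT; last by rewrite orbT.
by rewrite diff_ind_side //; case: (f == b).
Qed.

(** Up to a global sign, every cut realising the fundamental cocycle has the row
    of [b] as its coboundary: it vanishes on the rest of the tree, and a tension
    is determined by its values there. *)
Lemma fund_cocycle_cut (S : {set V}) : fund_cocycle G T b = cut G S ->
  diff G (ind S) b != 0 /\
  forall f, f \in edges G :\: T -> diff G (ind S) f = diff G (ind S) b * N b f.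
Proof.
move=> ED; have /andP[/minsetp/andP[/set0Pn[g gD] _] sD] := fund_cocycle_spec.
have Ediff f : f \in edges G :\: T -> diff G (ind S) f = diff G (ind S) b * N b f.
  move=> fT; rewrite (tension_off_tree FN (ind_tension S) fT).
  rewrite (big_setD1 b) //= big1 ?addr0 1?mulrC // => b'.
  rewrite in_setD1 => /andP[bb' b'T].
  suff : b' \notin cut G S.
    rewrite mem_cut (subsetP (spanning_sub tT) b' b'T) /= negbK => /eqP->.
    exact: mulr0.
  by rewrite -ED; apply: (contra (subsetP sD b')); rewrite !inE b'T (negPf bb').
split=> //; apply/eqP => b0; have gb := subsetP sD g gD; move: gD gb.
rewrite ED mem_cut in_setU1 => /andP[_ /negP gS] /orP[/eqP Eg|/Ediff Eg];
by case: gS; rewrite Eg b0 ?mul0r.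
Qed.

Lemma fund_cocycle_witness : exists2 S : {set V},
  S \subset verts G & fund_cocycle G T b = cut G S.
Proof.
have /andP[/minsetp/andP[_ /existsP[S /andP[SG /eqP ED]]] _] := fund_cocycle_spec.
by exists S.
Qed.

Lemma mem_fund_cocycle f : (f \in fund_cocycle G T b) =
  (f == b) || ((f \in edges G :\: T) && (N b f != 0)).
Proof.
have bG := subsetP (spanning_sub tT) b bT.
have [S _ ES] := fund_cocycle_witness; have [Sb ESf] := fund_cocycle_cut ES.
have [->|fb] /= := eqVneq f b; first by rewrite ES mem_cut bG.
case: (boolP (f \in edges G :\: T)) => fT /=.
  rewrite ES mem_cut ESf // mulf_eq0 (negPf Sb).
  by move: fT; rewrite inE => /andP[_ ->].
have /andP[_ sD] := fund_cocycle_spec.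
by apply: contraNF fT => /(subsetP sD); rewrite in_setU1 (negPf fb).
Qed.

Lemma fund_cocycle_side (S : {set V}) f : fund_cocycle G T b = cut G S ->
  f \in edges G :\: T -> N b f != 0 ->
  ((etail G b \in S) == (etail G f \in S)) = (N b f == 1).
Proof.
move=> /fund_cocycle_cut[Sb ESf] fT Nf; move: Sb (ESf f fT); rewrite /diff /ind.
case: FN => _ _ _ /(_ b f bT fT).
by move: (N b f) Nf => n Nf; case=> En; rewrite En in Nf *;
   case: (_ \in S) (_ \in S) (_ \in S) (_ \in S) => [] [] [] [].
Qed.

Lemma opposite_fund_cocycle f :
  opposite_in_cocycle G (fund_cocycle G T b) b f =
  (f \in edges G :\: T) && (N b f == -1).
Proof.
have [S SG ES] := fund_cocycle_witness.
have /andP[cD _] := fund_cocycle_spec.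
rewrite /opposite_in_cocycle cD !mem_fund_cocycle eqxx /=.
have [->|fb] /= := eqVneq f b.
  by rewrite inE bT /=; apply/existsP => -[S' /and3P[_ _ /eqP]].
apply/andP/andP => [[/andP[fT Nf] /existsP[S' /and3P[_ /eqP ES']]]|].
  rewrite (fund_cocycle_side ES') // => N1; split=> //.
  by case: FN => _ _ _ /(_ b f bT fT)[] EN; move: Nf N1; rewrite EN.
move=> [fT /eqP Nf]; rewrite fT Nf; split=> //.
by apply/existsP; exists S; rewrite SG ES eqxx (fund_cocycle_side ES) ?Nf.
Qed.

Lemma same_fund_cocycle f : f != b ->
  same_in_cocycle G (fund_cocycle G T b) b f =
  (f \in edges G :\: T) && (N b f == 1).
Proof.
have [S SG ES] := fund_cocycle_witness.
have /andP[cD _] := fund_cocycle_spec => fb.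
rewrite /same_in_cocycle cD !mem_fund_cocycle eqxx (negPf fb) /=.
apply/andP/andP => [[/andP[fT Nf] /existsP[S' /and3P[_ /eqP ES']]]|].
  by rewrite (fund_cocycle_side ES').
move=> [fT /eqP Nf]; rewrite fT Nf; split=> //.
by apply/existsP; exists S; rewrite SG ES eqxx (fund_cocycle_side ES) ?Nf.
Qed.

End FundamentalCocycle.

Lemma opposite_in_cocycleC D e f :
  opposite_in_cocycle G D e f = opposite_in_cocycle G D f e.
Proof.
rewrite /opposite_in_cocycle; congr (_ && _); rewrite andbCA; congr [&& _, _ & _].
by apply: eq_existsb => S; rewrite (eq_sym (etail G e \in S)).
Qed.

Lemma same_in_cocycleC D e f :
  same_in_cocycle G D e f = same_in_cocycle G D f e.
Proof.
rewrite /same_in_cocycle; congr (_ && _); rewrite andbCA; congr [&& _, _ & _].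
by apply: eq_existsb => S; rewrite (eq_sym (etail G e \in S)).
Qed.

End Trees.

(** * Deletion and contraction of an edge *)
Section MinorTrees.
Variables (V E : finType) (G : digraph V E) (w : E).
Hypothesis wG : w \in edges G.
Implicit Types (T C : {set E}) (N : E -> E -> int).

Lemma fundamental_deletion T N :
  w \notin T -> fundamental G T N -> fundamental (deletion G w) T N.
Proof.
move=> wT [sT tr fc Nv]; split.
- by rewrite subsetD1 sT.
- move=> b bT; have [pi Epi] := tr b bT; exists pi => f.
  by rewrite inE => /andP[_ /Epi].
- move=> e; rewrite !inE => /and3P[eT ew eG] pi.
  have := fc e; rewrite inE eT eG => /(_ isT pi).
  by rewrite (big_setD1 w) //= /fund_col (negPf wT) eq_sym (negPf ew) mul0r add0r.
- by move=> b e bT; rewrite !inE => /and3P[eT _ eG]; apply: Nv; rewrite ?inE ?eT.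
Qed.

Lemma spanning_deletion T : spanning_tree (deletion G w) T -> spanning_tree G T.
Proof.
case/and3P; rewrite subsetD1 => /andP[sT wT] cT /forallP aT.
apply/and3P; split=> //; apply/forallP => C; apply/implyP => /cycleP[c tc].
apply/negP => sC; have := aT C; rewrite sC implybF => /negP[].
apply/cycleP; exists c; case/and5P: tc => c0 cc us uf /andP[EC _].
apply/and5P; split=> //.
rewrite EC; apply: subset_trans sC _; by rewrite subsetD1 sT.
Qed.

Lemma merge_potential (pi : V -> int) v :
  pi (ehead G w) = pi (etail G w) -> pi (Defs.merge G w v) = pi v.
Proof. by rewrite /Defs.merge; case: eqP => [->|]. Qed.

Lemma diff_contraction (pi : V -> int) f :
  pi (ehead G w) = pi (etail G w) -> diff (contraction G w) pi f = diff G pi f.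
Proof. by move=> Epi; rewrite /diff /= !merge_potential. Qed.

(** Potentials of the contraction are the potentials of [G] that do not see
    [w]. *)
Lemma flow_contraction x : flow G x -> flow (contraction G w) x.
Proof.
move=> Fx pi; have := Fx (pi \o Defs.merge G w).
rewrite (big_setD1 w) //= {1}/diff /= /Defs.merge eqxx; case: (_ == _);
by rewrite subrr mulr0 add0r.
Qed.

Lemma fundamental_contraction T N :
  w \in T -> fundamental G T N -> fundamental (contraction G w) (T :\ w) N.
Proof.
move=> wT [sT tr fc Nv].
have ET : edges (contraction G w) :\: (T :\ w) = edges G :\: T.
  by apply/setP => f; rewrite !inE negb_and negbK; case: eqP => [->|]; rewrite //= wT.
split.
- exact: setSD.
- move=> b /setD1P[bw bT]; have [pi Epi] := tr b bT; exists pi => f.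
  have Ew : pi (ehead G w) = pi (etail G w).
    apply/eqP; rewrite -subr_eq0 -/(diff G pi w) -Epi // /fund_row wT.
    by rewrite [w == b]eq_sym (negPf bw).
  rewrite !inE => /andP[fw fG]; rewrite diff_contraction // -Epi //.
  by rewrite /fund_row !inE fw.
- move=> e; rewrite ET => eT.
  have Ee : {in edges G :\ w, fund_col (T :\ w) N e =1 fund_col T N e}.
    by move=> f; rewrite /fund_col !inE => /andP[-> _].
  move=> pi; rewrite -[RHS](flow_contraction (fc e eT) pi).
  by apply: eq_bigr => f /Ee->.
- by move=> b e /setD1P[_ bT]; rewrite ET; apply: Nv.
Qed.

(** A flow carried by [w |: T] restricts to one of the contraction carried by a
    spanning tree there, so it lives on [w] alone; as [w] is not a loop, it is
    zero.  This excludes cycles. *)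
Lemma spanning_contraction T : etail G w != ehead G w ->
  spanning_tree (contraction G w) T -> spanning_tree G (w |: T).
Proof.
move=> nl tT; have [N FN] := spanning_fundamental tT.
have sTw := spanning_sub tT; have := sTw; rewrite subsetD1 => /andP[sT wT].
have cG : connected_by G (w |: T).
  move=> S ST u v uG vG.
  have mS x : (Defs.merge G w x \in S) = (x \in S).
    rewrite /Defs.merge; case: eqP => // ->.
    by apply: ST; rewrite !inE eqxx.
  rewrite -[u \in S]mS -[v \in S]mS.
  apply: (spanning_connected tT) => [f fT||].
  - by rewrite /= !mS ST // inE fT orbT.
  - exact: imset_f.
  - exact: imset_f.
apply/and3P; split.
- by rewrite subUset sub1set wG.
- apply/forall_inP => u uG; apply/forall_inP => v vG.
  exact: connected_connect cG uG vG.
apply/forallP => C; apply/implyP => /cycleP[c tc]; apply/negP => sC.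
have x0 f : f != w -> walk_vector c f = 0.
  move=> fw; case: (boolP (f \in T)) => fT; last first.
    apply: walk_vector_notin; rewrite -(traverses_mem _ tc).
    by apply: contra fT => /(subsetP sC); rewrite !inE (negPf fw).
  rewrite (flow_on_tree FN (flow_contraction (walk_flow tc)) fT) big1 ?oppr0 // => g.
  rewrite !inE => /and3P[gT gw gG]; rewrite walk_vector_notin ?mul0r //.
  rewrite -(traverses_mem _ tc); apply: contra gT => /(subsetP sC).
  by rewrite !inE (negPf gw).
have xw : walk_vector c w = 0.
  have := walk_flow tc (ind [set ehead G w]).
  rewrite (big_setD1 w) //= big1 ?addr0 => [|f /setD1P[fw _]]; last by rewrite x0 ?mul0r.
  by rewrite /diff /ind !inE eqxx (negPf nl) subr0 mulr1.
have xall f : walk_vector c f = 0 by have [->|/x0] := eqVneq f w.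
case/and5P: (tc); case: c {x0 xw} tc xall => // -[b s] c tc xall _ _ _ _ _.
have := walk_vector_in (traverses_uniq tc) (mem_head _ _).
by rewrite xall; case: s {tc xall}.
Qed.

End MinorTrees.

(** * Reversal of an edge *)
Section Reorientation.
Variables (V E : finType) (G : digraph V E) (w : E).

Lemma reorient_ends e : e \in edges G ->
  ((if e == w then ehead G e else etail G e) \in verts G) &&
  ((if e == w then etail G e else ehead G e) \in verts G).
Proof. by move=> /ends_in_verts/andP[te he]; case: eqP; rewrite te he. Qed.

Definition reorient : digraph V E := Digraph reorient_ends.

Definition rsign (f : E) : int := if f == w then -1 else 1.

Lemma rsignK f : rsign f * rsign f = 1.
Proof. by rewrite /rsign; case: (f == w). Qed.

Lemma diff_reorient (pi : V -> int) f :
  diff reorient pi f = rsign f * diff G pi f.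
Proof. rewrite /diff /rsign /=; case: (f == w); lia. Qed.

(** Cycles and cocycles are kept, and their coordinate at [w] changes sign;
    normalising them again to 1 at their own edge changes the signs of the row
    or column of [w], in particular. *)
Lemma fundamental_reorient T N : fundamental G T N ->
  fundamental reorient T (fun b e => rsign b * rsign e * N b e).
Proof.
case=> sT tr fc Nv; split=> // [b bT|e eT pi|b e bT eT].
- have [pi Epi] := tr b bT; exists (fun v => rsign b * pi v) => f fG.
  rewrite diff_reorient.
  transitivity (rsign b * rsign f * diff G pi f); last by rewrite /diff; ring.
  rewrite -Epi // /fund_row; case: (f \in T) => //.
  by case: eqP => [->|]; rewrite ?rsignK ?mulr0.
- transitivity (rsign e * \sum_(f in edges G) fund_col T N e f * diff G pi f);
    last by rewrite fc ?mulr0.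
  rewrite big_distrr; apply: eq_bigr => f fG; rewrite diff_reorient /=.
  transitivity (rsign e * ((rsign f * rsign f) * fund_col T N e f) * diff G pi f);
    last by rewrite rsignK; ring.
  rewrite [RHS](_ : _ =
    (rsign e * rsign f * fund_col T N e f) * (rsign f * diff G pi f)); last by ring.
  congr (_ * _); rewrite /fund_col; case: (f \in T); first by ring.
  by case: eqP => [->|]; rewrite ?rsignK ?mulr0.
rewrite /rsign; case: (Nv b e bT eT) => ->; case: (b == w); case: (e == w);
  by [constructor 1|constructor 2|constructor 3].
Qed.

Lemma connected_reorient T : connected_by G T -> connected_by reorient T.
Proof.
move=> cT S ST; apply: cT => f /ST /=; by case: (f == w).
Qed.

Lemma spanning_reorient T : spanning_tree G T -> spanning_tree reorient T.
Proof.
move=> tT; have [N FN] := spanning_fundamental tT.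
apply: fundamental_spanning (fundamental_reorient FN).
apply: connected_byS (connected_reorient (spanning_connected tT)).
exact: spanning_sub tT.
Qed.

End Reorientation.

(** * Bipolar digraphs *)
Section Bipolar.
Variables (V E : finType).
Implicit Types (G : digraph V E) (p w : E).

Definition increasing G (pi : V -> int) := {in edges G, forall f, 0 < diff G pi f}.

(** In an acyclic digraph the number of vertices from which a given vertex can
    be reached increases along every edge.  Conversely, the increments of a
    potential add up to zero along a cycle. *)
Lemma acyclicP G : acyclic G <-> exists pi, increasing G pi.
Proof.
split=> [aG|[pi inc]]; last first.
  apply/forallP => C; apply/negP => /(traverses_tuple _ (all snd))[c tc fw].
  have [c0 cc _ _ /andP[_ /subsetP CG]] := and5P tc.
  have := sum_cycle pi cc; case: c c0 tc fw {cc} => // d c _ tc fw.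
  have pos d' : d' \in d :: c -> 0 < pi (dart_dst G d') - pi (dart_src G d').
    move=> d'c; rewrite diff_dart (allP fw d' d'c) mul1r; apply: inc.
    by apply: CG; rewrite (traverses_mem _ tc) map_f.
  rewrite big_cons => /eqP; rewrite gt_eqF // ltr_wpDr ?pos ?mem_head //.
  by rewrite big_seq sumr_ge0 // => d' d'c; rewrite ltW ?pos // inE d'c orbT.
pose r : rel V := fun u v => [exists e in edges G, (etail G e == u) && (ehead G e == v)].
have re e : e \in edges G -> r (etail G e) (ehead G e).
  by move=> eG; apply/existsP; exists e; rewrite eG !eqxx.
exists (fun v => #|[set z | connect r z v]|%:Z) => e eG.
rewrite subr_gt0 ltz_nat; apply: proper_card; apply/properP; split.
  apply/subsetP => z; rewrite !inE => h; apply: connect_trans h (connect1 _).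
  exact: re.
exists (ehead G e); rewrite !inE ?connect0 //; apply/negP => ce.
have [|p [pp Ep up Pp]] := @connect_chain _ _ G r
  (fun d => d.2 && (d.1 \in edges G)) (e, true) (etail G e) _ ce.
  move=> v v' /existsP[f /andP[fG /andP[/eqP<- /eqP<-]]].
  by exists (f, true); rewrite /= fG.
have dP d : d \in p -> d.2 /\ d.1 \in edges G by move=> /(allP Pp)/andP.
have tp := @traverses_closed_chain _ _ G (e, true) p pp Ep up.
case/negP: (forallP aG [set f in map fst ((e, true) :: p)]).
apply/(traverses_tuple _ (all snd)); exists ((e, true) :: p).
  apply: tp => /=; last by rewrite eG; apply/allP => d /dP[].
  apply/negP => /mapP[[f s] dp /= Ef]; move: (up) => /=.
  have [/= Es _] := dP _ dp; rewrite Ef.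
  suff -> : dart_dst G (f, true) \in map (dart_dst G) p by [].
  by apply/mapP; exists (f, s); rewrite // /dart_dst Es.
by apply/allP => d; rewrite inE => /orP[/eqP->//|/dP[]].
Qed.

(** Bipolarity in a form adapted to minors: an increasing potential already
    forces the tail of [p] to be a source and its head to be a sink, as soon as
    every other vertex is entered or left, respectively. *)
Definition bipolar_digraph G p := [/\ p \in edges G,
  exists pi, increasing G pi,
  forall v, v \in verts G -> v != etail G p ->
    exists2 f, f \in edges G & ehead G f = v
  & forall v, v \in verts G -> v != ehead G p ->
    exists2 f, f \in edges G & etail G f = v].

(** A vertex that minimises an increasing potential is entered by no edge, so it
    is the tail of [p]; dually for the head. *)
Lemma increasing_bounds G p pi v : bipolar_digraph G p -> increasing G pi ->
  v \in verts G -> pi (etail G p) <= pi v <= pi (ehead G p).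
Proof.
move=> [pG _ inE outE] inc vG.
have [m mG mmin] := arg_minP pi vG; have [M MG Mmax] := arg_maxP pi vG.
have Em : m = etail G p.
  apply/eqP/negPn/negP => /(inE m mG)[f fG Ef].
  have /andP[tG _] := ends_in_verts fG; have := mmin _ tG; have := inc f fG.
  rewrite /diff Ef; lia.
have EM : M = ehead G p.
  apply/eqP/negPn/negP => /(outE M MG)[f fG Ef].
  have /andP[_ hG] := ends_in_verts fG; have := Mmax _ hG; have := inc f fG.
  rewrite /diff Ef; lia.
by rewrite -Em -EM; apply/andP; split; [apply: mmin | apply: Mmax].
Qed.

Lemma increasing_noloop G pi f :
  increasing G pi -> f \in edges G -> etail G f != ehead G f.
Proof.
by move=> inc fG; have := inc f fG; rewrite /diff; case: eqP => // ->; rewrite subrr.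
Qed.

Lemma bipolarP G p : bipolar G p <-> bipolar_digraph G p.
Proof.
split.
  case/and3P => pG /acyclicP[pi inc] /existsP[s /existsP[t /and3P[]]].
  move=> /eqP Es /eqP Et /eqP Est; have nl := increasing_noloop inc pG.
  have /andP[tG hG] := ends_in_verts pG.
  have tp : etail G p != t.
    apply/eqP => tt; have : t \in sinks G by rewrite Et set11.
    by rewrite inE => /andP[_ /forall_inP/(_ p pG)]; rewrite tt eqxx.
  have hs : ehead G p != s.
    apply/eqP => tt; have : s \in sources G by rewrite Es set11.
    by rewrite inE => /andP[_ /forall_inP/(_ p pG)]; rewrite tt eqxx.
  have Es' : etail G p = s.
    by have : etail G p \in [set s; t]; rewrite Est !inE ?eqxx // -?Est;
    move: (set21 (etail G p) (ehead G p)); rewrite -Est !inE (negPf tp) orbF => /eqP.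
  have Et' : ehead G p = t.
    by move: (set22 (etail G p) (ehead G p)); rewrite -Est !inE (negPf hs) => /eqP.
  split=> //; first by exists pi.
    move=> v vG vp; have : v \notin sources G by rewrite Es inE -Es'.
    rewrite inE vG negb_forall_in => /exists_inP[f fG]; rewrite negbK => /eqP.
    by exists f.
  move=> v vG vp; have : v \notin sinks G by rewrite Et inE -Et'.
  rewrite inE vG negb_forall_in => /exists_inP[f fG]; rewrite negbK => /eqP.
  by exists f.
move=> bG; have [pG [pi inc] inE' outE] := bG.
have /andP[tG hG] := ends_in_verts pG.
apply/and3P; split=> //; first by apply/acyclicP; exists pi.
apply/existsP; exists (etail G p); apply/existsP; exists (ehead G p).
rewrite eqxx andbT; apply/andP; split; apply/eqP/setP => v; rewrite !inE.
  apply/andP/eqP => [[vG /forall_inP src]|->].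
    apply/eqP/negPn/negP => /(inE' v vG)[f fG Ef].
    by have := src f fG; rewrite Ef eqxx.
  split=> //; apply/forall_inP => f fG; apply/negP => /eqP Ef.
  have /andP[tf _] := ends_in_verts fG.
  have /andP[+ _] := increasing_bounds bG inc tf.
  by rewrite -Ef leNgt -subr_gt0 inc.
apply/andP/eqP => [[vG /forall_inP src]|->].
  apply/eqP/negPn/negP => /(outE v vG)[f fG Ef].
  by have := src f fG; rewrite Ef eqxx.
split=> //; apply/forall_inP => f fG; apply/negP => /eqP Ef.
have /andP[_ hf] := ends_in_verts fG.
have /andP[_ +] := increasing_bounds bG inc hf.
by rewrite -Ef leNgt -subr_gt0 inc.
Qed.

(** Along an isthmus [w] other than [p] an increasing potential could be
    stretched without changing its values at the ends of [p], which bound all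
    others. *)
Lemma bipolar_no_isthmus G p w pi : bipolar_digraph G p -> w \in edges G ->
  w != p -> {in edges G, forall f, diff G pi f = (f == w)%:R} -> False.
Proof.
move=> bG wG wp Epi; have [pG [rho inc] _ _] := bG.
(* This slope makes [tau] rise more along [w] than from the tail to the head
   of [p], where it rises by [K]. *)
pose K := diff G rho p; pose tau v := rho v + K * pi v.
have Etau f : diff G tau f = diff G rho f + K * diff G pi f.
  by rewrite /diff /tau; ring.
have inct : increasing G tau.
  move=> f fG; rewrite Etau Epi // ltr_wpDr ?inc // mulr_ge0 ?ler0n //.
  exact/ltW/inc.
have /andP[tG hG] := ends_in_verts wG.
have /andP[lo _] := increasing_bounds bG inct tG.
have /andP[_ hi] := increasing_bounds bG inct hG.
have := Etau w; have := Etau p; have := inc w wG.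
rewrite !Epi // eqxx (negPf (_ : p != w)) 1?eq_sym // mulr0 mulr1 -/K.
move: lo hi; rewrite {1 2 3 4}/diff; lia.
Qed.

(** Only acyclicity can be lost in a contraction: a vertex of the contraction
    other than the ends of [p] is entered and left as it was, since the merged
    vertex is entered through the tail of [w] and left through its head. *)
Lemma bipolar_contraction G p w pi : bipolar_digraph G p -> w \in edges G ->
  w != p -> diff G pi w = 0 -> {in edges G :\ w, forall f, 0 < diff G pi f} ->
  bipolar_digraph (contraction G w) p.
Proof.
move=> bG wG wp pw pinc; have [pG [rho inc] inE' outE] := bG.
have Ew : pi (ehead G w) = pi (etail G w).
  by apply/eqP; rewrite -subr_eq0 -/(diff G pi w) pw.
have nl := increasing_noloop inc wG.
have merge_not_head x : Defs.merge G w x != ehead G w.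
  by rewrite /Defs.merge; have [] := eqVneq x (ehead G w).
have merge_id x : x != ehead G w -> Defs.merge G w x = x.
  by rewrite /Defs.merge => /negPf->.
split.
- by rewrite !inE eq_sym wp.
- by exists pi => f fG; rewrite diff_contraction // pinc.
- move=> _ /imsetP[x xG ->] /= xp.
  have yG : Defs.merge G w x \in verts G.
    by rewrite /Defs.merge; case: eqP => // _; have /andP[] := ends_in_verts wG.
  have [|f fG Ef] := inE' _ yG.
    by apply: contraNneq xp => <-; rewrite (merge_id _ (merge_not_head x)).
  exists f; last by rewrite Ef merge_id // merge_not_head.
  rewrite !inE fG andbT; apply: contraTneq (merge_not_head x) => Efw.
  by rewrite -Ef Efw eqxx.
- move=> _ /imsetP[x xG ->] /= xp.
  have [Ex|nx] := eqVneq (Defs.merge G w x) (etail G w); last first.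
    have yG : Defs.merge G w x \in verts G.
      by rewrite /Defs.merge; case: eqP => // _; have /andP[] := ends_in_verts wG.
    have [|f fG Ef] := outE _ yG.
      by apply: contraNneq xp => <-; rewrite (merge_id _ (merge_not_head x)).
    exists f; last by rewrite Ef merge_id // merge_not_head.
    rewrite !inE fG andbT; apply: contraNneq nx => Efw.
    by rewrite -Ef Efw.
  have /andP[_ hG] := ends_in_verts wG.
  have [|f fG Ef] := outE _ hG.
    by apply: contraNneq xp => <-; rewrite Ex /Defs.merge eqxx.
  exists f; last by rewrite Ef Ex /Defs.merge eqxx.
  rewrite !inE fG andbT; apply: contraNneq nl => Efw.
  by rewrite -Ef Efw.
Qed.

Lemma bipolar_deletion G p w : bipolar_digraph G p -> w != p ->
  (etail G p != ehead G w -> exists2 f, f \in edges G :\ w & ehead G f = ehead G w) ->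
  (ehead G p != etail G w -> exists2 f, f \in edges G :\ w & etail G f = etail G w) ->
  bipolar_digraph (deletion G w) p.
Proof.
move=> [pG [pi inc] inE' outE] wp inw outw; split.
- by rewrite !inE eq_sym wp.
- by exists pi => f /setD1P[_ fG]; apply: inc.
- move=> v vG vp; have [f fG Ef] := inE' v vG vp.
  have [Efw|fw] := eqVneq f w; last by exists f; rewrite // !inE fw.
  by rewrite -Ef Efw; apply: inw; rewrite -Efw Ef eq_sym.
- move=> v vG vp; have [f fG Ef] := outE v vG vp.
  have [Efw|fw] := eqVneq f w; last by exists f; rewrite // !inE fw.
  by rewrite -Ef Efw; apply: outw; rewrite -Efw Ef eq_sym.
Qed.

(** If the deletion fails to be bipolar, then [w] is the only edge into its head
    or the only edge out of its tail.  Moving that end of [w] to the level of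
    the other one then keeps all other edges increasing, so that [w] can be
    contracted. *)
Lemma bipolar_minor G p w : bipolar_digraph G p -> w \in edges G -> w != p ->
  bipolar_digraph (contraction G w) p \/ bipolar_digraph (deletion G w) p.
Proof.
move=> bG wG wp; have [pG [pi inc] _ _] := bG.
have nl := increasing_noloop inc wG; have := inc w wG.
rewrite {1}/diff => incw.
have nlf f : f \in edges G -> etail G f != ehead G f := increasing_noloop inc.
have [/exists_inP[f fw /eqP Ef]|/exists_inPn noin] :=
  boolP [exists f in edges G :\ w, ehead G f == ehead G w]; last first.
  left; pose tau v := if v == ehead G w then pi (etail G w) else pi v.
  apply: (bipolar_contraction (pi := tau)) => //.
    by rewrite /diff /tau eqxx (negPf nl) subrr.
  move=> f fw; have /setD1P[_ fG] := fw; have := inc f fG.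
  rewrite /diff /tau (negPf (noin f fw)); case: eqP => // ->; lia.
have [/exists_inP[g gw /eqP Eg]|/exists_inPn noout] :=
  boolP [exists f in edges G :\ w, etail G f == etail G w]; last first.
  left; pose tau v := if v == etail G w then pi (ehead G w) else pi v.
  apply: (bipolar_contraction (pi := tau)) => //.
    by rewrite /diff /tau eqxx eq_sym (negPf nl) subrr.
  move=> h hw; have /setD1P[_ hG] := hw; have := inc h hG.
  rewrite /diff /tau (negPf (noout h hw)); case: eqP => // ->; lia.
right; apply: bipolar_deletion => // _; [by exists f | by exists g].
Qed.

(** A positive combination of the potentials for the two orientations of [w]
    cancels on [w]. *)
Lemma bipolar_reorient_contraction G p w : bipolar_digraph G p ->
  w \in edges G -> w != p -> bipolar_digraph (reorient G w) p ->
  bipolar_digraph (contraction G w) p.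
Proof.
move=> bG wG wp [_ [rho incr] _ _]; have [_ [pi inc] _ _] := bG.
(* The increments of [pi] and [rho] along [w] have opposite signs. *)
pose a := diff G pi w; pose c := diff (reorient G w) rho w.
have a0 : 0 < a by apply: inc.
have c0 : 0 < c by apply: incr.
have Etau f : diff G (fun v => c * pi v + a * rho v) f =
    c * diff G pi f + a * diff G rho f by rewrite /diff; ring.
apply: (bipolar_contraction (pi := fun v => c * pi v + a * rho v)) => //.
  by rewrite Etau /c diff_reorient /rsign eqxx -/a; ring.
move=> f /setD1P[fw fG]; rewrite Etau addr_gt0 ?mulr_gt0 ?inc //.
by have := incr f fG; rewrite diff_reorient /rsign (negPf fw) mul1r.
Qed.

Lemma bipolar_reorient_deletion G p w : bipolar_digraph G p ->
  w \in edges G -> w != p -> bipolar_digraph (reorient G w) p ->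
  bipolar_digraph (deletion G w) p.
Proof.
move=> bG wG wp [_ _ inR outR]; have /andP[tG hG] := ends_in_verts wG.
have [_ [pi inc] _ _] := bG; have nl := increasing_noloop inc wG.
have pw : (p == w) = false by rewrite eq_sym (negPf wp).
apply: bipolar_deletion => // [tp|hp].
  have [|f fG Ef] := inR _ hG; first by rewrite /= pw eq_sym.
  move: Ef => /=; have [->|fw] := eqVneq f w => Ef; last by exists f; rewrite // !inE fw.
  by rewrite Ef eqxx in nl.
have [|f fG Ef] := outR _ tG; first by rewrite /= pw eq_sym.
move: Ef => /=; have [->|fw] := eqVneq f w => Ef; last by exists f; rewrite // !inE fw.
by rewrite Ef eqxx in nl.
Qed.

End Bipolar.

(** * Leading entries and lexicographic weights *)
Section Ordered.
Variables (disp : Order.disp_t) (E : finOrderType disp).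
Implicit Types (A B T : {set E}) (N : E -> E -> int) (a : E -> int).
Implicit Types (b e f g m p w : E).

Lemma is_minP A m : reflect (m \in A /\ forall x, x \in A -> (m <= x)%O) (is_min A m).
Proof. by apply: (iffP andP) => -[mA /forall_inP]. Qed.

Lemma is_maxP A m : reflect (m \in A /\ forall x, x \in A -> (x <= m)%O) (is_max A m).
Proof. by apply: (iffP andP) => -[mA /forall_inP]. Qed.

Lemma is_min_inj A m m' : is_min A m -> is_min A m' -> m = m'.
Proof.
move=> /is_minP[mA minm] /is_minP[m'A minm'].
by apply/eqP; rewrite eq_le minm // minm'.
Qed.

(** The optimality condition on one line [a] of the matrix, the line of [f]:
    its first nonzero entry comes before [f] and has the right sign. *)
Definition leads B a m f :=
  [/\ m \in B, (m < f)%O, a m = 1 & forall g, g \in B -> a g != 0 -> (m <= g)%O].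

Lemma eq_leads B a a' m f : {in B, a =1 a'} -> leads B a m f -> leads B a' m f.
Proof.
by move=> Ea [mB mf am minm]; split=> // [|g gB]; rewrite -Ea //; apply: minm.
Qed.

Lemma leads_or B a w : (forall g, g \in B -> (g < w)%O) ->
  (forall g, g \in B -> [\/ a g = 0, a g = 1 | a g = -1]) ->
  (exists2 g, g \in B & a g != 0) ->
  exists m, leads B a m w \/ leads B (fun g => - a g) m w.
Proof.
move=> ltw va [g gB ag].
have P0 : (g \in B) && (a g != 0) by rewrite gB.
have [m /andP[mB am] minm] :=
  @arg_minP _ _ _ g (fun g => (g \in B) && (a g != 0)) id P0.
exists m; case: (va m mB) => Em; first by rewrite Em eqxx in am.
  left; split=> //; first exact: ltw.
  by move=> h hB ah; apply: minm; rewrite hB.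
right; split=> //; [exact: ltw | by rewrite Em opprK |].
by move=> h hB; rewrite oppr_eq0 => ah; apply: minm; rewrite hB.
Qed.

(** Opposite directions in the cycle of [e] mean that its coordinates at [m] and
    [e] have product -1, which is the entry 1 in [N] because columns store
    cycles with a change of sign. *)
Definition optimal_matrix A T p N :=
  (forall e, e \in A :\: T -> exists m, leads T (N^~ e) m e) /\
  (forall b, b \in T -> b != p -> exists m, leads (A :\: T) (fun e => - N b e) m b).

Lemma eq_optimal_matrix A T p N N' :
  (forall b e, b \in T -> e \in A :\: T -> N b e = N' b e) ->
  optimal_matrix A T p N -> optimal_matrix A T p N'.
Proof.
move=> EN [opte optb]; split=> [e eT|b bT bp].
  have [m lm] := opte e eT; exists m.
  by apply: eq_leads lm => b bT; apply: EN.
have [m lm] := optb b bT bp; exists m.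
by apply: eq_leads lm => e eT; rewrite EN.
Qed.

Definition weight f : int := 2 ^+ #|[set g | (f < g)%O]|.

Lemma weight_gt0 f : 0 < weight f.
Proof. exact: exprn_gt0. Qed.

(** The exponents are 0, 1, 2, and so on, up to [#|A|.-1]. *)
Lemma sum_powers A :
  \sum_(g in A) (2 ^+ #|[set h in A | (g < h)%O]| : int) < 2 ^+ #|A|.
Proof.
have [k] := ubnP #|A|; elim: k A => // k IHk A leAk.
have [->|[g0 g0A]] := set_0Vmem A; first by rewrite big_set0 cards0.
have [m mA minm] := @arg_minP _ _ _ g0 (fun g => g \in A) id g0A.
have card := cardsD1 m A; rewrite mA add1n in card.
rewrite (big_setD1 m) //= card exprS.
have -> : [set h in A | (m < h)%O] = A :\ m.
  apply/setP => h; rewrite !inE andbC.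
  case: (boolP (h \in A)) => //= hA; last by rewrite !andbF.
  by rewrite !andbT lt_def (minm h hA) andbT.
rewrite (_ : 2 * _ = 2 ^+ #|A :\ m| + 2 ^+ #|A :\ m|); last by ring.
rewrite ltrD2l.
have -> : \sum_(g in A :\ m) (2 ^+ #|[set h in A | (g < h)%O]| : int) =
          \sum_(g in A :\ m) 2 ^+ #|[set h in A :\ m | (g < h)%O]|.
  apply: eq_bigr => g /setD1P[_ gA]; congr (2 ^+ _); apply: eq_card => h.
  rewrite !inE; case: (eqVneq h m) => //= ->.
  by rewrite ltNge minm // andbF.
by apply: IHk; rewrite -ltnS -card.
Qed.

Lemma weight_tail m : \sum_(g | (m < g)%O) weight g < weight m.
Proof.
have := sum_powers [set g | (m < g)%O]; rewrite /weight.
under eq_bigl do rewrite inE.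
congr (_ < _); apply: eq_bigr => g mg; congr (2 ^+ _); apply: eq_card => h.
rewrite !inE; case: (boolP (g < h)%O) => [gh|]; rewrite ?andbF // andbT.
by rewrite (lt_trans mg gh).
Qed.

(** The leading entry contributes [weight m], which exceeds the total weight of
    all later edges; [f] itself is one of these and is not used up by [B]. *)
Lemma leads_dominates B a m f : leads B a m f -> f \notin B ->
  (forall g, g \in B -> [\/ a g = 0, a g = 1 | a g = -1]) ->
  weight f < \sum_(g in B) weight g * a g.
Proof.
move=> [mB mf am minm] fB va; have := weight_tail m.
rewrite (bigD1 f) //= [X in _ -> _ < X](big_setD1 m) //= am mulr1.
(* All other nonzero entries come after [m] and are at least -1. *)
have : 0 <= \sum_(g | (m < g)%O && (g != f)) weight g
            + \sum_(g in B :\ m) weight g * a g.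
  rewrite [X in X + _]big_mkcond [X in _ + X]big_mkcond -big_split /=.
  apply: sumr_ge0 => g _; have wg := weight_gt0 g.
  rewrite !inE; case: (boolP (g \in B)) => gB; last first.
    by rewrite andbF addr0; case: ifP => // _; apply: ltW.
  have gf : g != f by apply: contraNneq fB => <-.
  have [->|gm] := eqVneq g m; first by rewrite ltxx addr0.
  rewrite gf andbT /=; case: (va g gB) => ag; rewrite ag.
  - by rewrite mulr0 addr0; case: ifP => // _; apply: ltW.
  - by rewrite mulr1; case: ifP => // _; rewrite ?add0r ?addr_ge0 // ltW.
  - have -> : (m < g)%O by rewrite lt_neqAle eq_sym gm minm // ag.
    by rewrite mulrN1 subrr.
move: (\sum_(g | _ && _) _) (\sum_(g in B :\ m) _) => S1 S2.
move: (weight m) (weight f) => wm wf; lia.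
Qed.

End Ordered.

(** * Uniqueness of the fully optimal spanning tree *)
Section Optimality.
Variables (disp : Order.disp_t) (V : finType) (E : finOrderType disp).
Implicit Types (G : digraph V E) (T : {set E}) (N : E -> E -> int).
Implicit Types (b e f m p w : E).

Lemma fund_cycle_min G T N e m : spanning_tree G T -> fundamental G T N ->
  e \in edges G :\: T ->
  is_min (fund_cycle G T e) m && (m != e) <->
  [/\ m \in T, (m < e)%O, N m e != 0 & forall g, g \in T -> N g e != 0 -> (m <= g)%O].
Proof.
move=> tT FN eT; have memC := mem_fund_cycle tT FN eT.
split=> [/andP[/is_minP[mC minm] me]|[mT me Nm minm]].
  move: mC; rewrite memC (negPf me) => /andP[mT Nm]; split=> //.
    by rewrite lt_neqAle me minm // memC eqxx.
  by move=> g gT Ng; apply: minm; rewrite memC gT Ng orbT.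
rewrite lt_eqF // andbT; apply/is_minP; split; first by rewrite memC mT Nm orbT.
move=> g; rewrite memC => /orP[/eqP->|/andP[gT Ng]]; first exact: ltW.
exact: minm.
Qed.

Lemma fund_cocycle_min G T N b m : spanning_tree G T -> fundamental G T N ->
  b \in T ->
  is_min (fund_cocycle G T b) m && (m != b) <->
  [/\ m \in edges G :\: T, (m < b)%O, N b m != 0
    & forall g, g \in edges G :\: T -> N b g != 0 -> (m <= g)%O].
Proof.
move=> tT FN bT; have memD := mem_fund_cocycle tT FN bT.
split=> [/andP[/is_minP[mC minm] me]|[mT me Nm minm]].
  move: mC; rewrite memD (negPf me) => /andP[mT Nm]; split=> //.
    by rewrite lt_neqAle me minm // memD eqxx.
  by move=> g gT Ng; apply: minm; rewrite memD gT Ng orbT.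
rewrite lt_eqF // andbT; apply/is_minP; split; first by rewrite memD mT Nm orbT.
move=> g; rewrite memD => /orP[/eqP->|/andP[gT Ng]]; first exact: ltW.
exact: minm.
Qed.

Lemma fully_optimalP G T N p : is_min (edges G) p ->
  spanning_tree G T -> fundamental G T N ->
  fully_optimal G T <-> optimal_matrix (edges G) T p N.
Proof.
move=> minp tT FN; split=> [/and3P[_ /forall_inP optb /forall_inP opte]|[opte optb]].
  split=> [e eT|b bT bp].
    have /existsP[m /andP[minm]] := opte e eT.
    rewrite (opposite_fund_cycle tT FN eT) => /andP[mT /eqP Nm].
    have me : m != e by apply: contraTneq mT => ->; case/setDP: eT.
    have [|_ lt_me _ leg] := (fund_cycle_min m tT FN eT).1; first by rewrite minm.
    by exists m.
  have /implyP/(_ _)/existsP[|m /andP[minm]] := optb b bT.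
    by apply: contra bp => minb; rewrite (is_min_inj minb minp).
  rewrite (opposite_fund_cocycle tT FN bT) => /andP[mT /eqP Nm].
  have mb : m != b by apply: contraTneq bT => <-; case/setDP: mT.
  have [|_ lt_mb _ leg] := (fund_cocycle_min m tT FN bT).1; first by rewrite minm.
  exists m; split=> // [|g gT]; first by rewrite Nm.
  by rewrite oppr_eq0; apply: leg.
apply/and3P; split=> //; apply/forall_inP.
  move=> b bT; apply/implyP => minb.
  have bp : b != p by apply: contraNneq minb => ->.
  have [m [mT mb Nm leg]] := optb b bT bp.
  have {}Nm : N b m = -1 by rewrite -Nm opprK.
  apply/existsP; exists m; rewrite (opposite_fund_cocycle tT FN bT) mT Nm andbT.
  suff /andP[->] : is_min (fund_cocycle G T b) m && (m != b) by [].
  apply/(fund_cocycle_min m tT FN bT); split=> // [|g gT Ng]; first by rewrite Nm.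
  by apply: leg; rewrite ?oppr_eq0.
move=> e eT; have [m [mT me Nm leg]] := opte e eT.
apply/existsP; exists m; rewrite (opposite_fund_cycle tT FN eT) mT Nm andbT.
suff /andP[->] : is_min (fund_cycle G T e) m && (m != e) by [].
by apply/(fund_cycle_min m tT FN eT); split=> //; rewrite Nm.
Qed.

Section Certificates.
Variables (G : digraph V E) (p : E) (minp : is_min (edges G) p).

Definition tension_of T N f := \sum_(b in T) weight b * fund_row T N b f.
Definition flow_of T N f :=
  \sum_(e in edges G :\: T) weight e * fund_col T N e f.

Section Certificate.
Variables (T : {set E}) (N : E -> E -> int).
Hypotheses (FN : fundamental G T N) (optN : optimal_matrix (edges G) T p N).

Lemma min_in_tree : p \in T.
Proof.
have /is_minP[pG lep] := minp; apply/negPn/negP => pT.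
have [|m [mT mp _ _]] := optN.1 p; first by rewrite inE pT.
by move: mp; rewrite ltNge lep // (subsetP (fundamental_sub FN)).
Qed.

Lemma tension_ofP : tension G (tension_of T N).
Proof. by case: FN => _ tr _ _; apply: tension_sum. Qed.

Lemma flow_ofP : flow G (flow_of T N).
Proof. by case: FN => _ _ fc _; apply: flow_sum. Qed.

Lemma tension_of_in f : f \in T -> tension_of T N f = weight f.
Proof.
move=> fT; rewrite /tension_of (big_setD1 f) //= /fund_row fT eqxx mulr1.
rewrite big1 ?addr0 // => b; rewrite in_setD1 eq_sym => /andP[/negPf-> _].
exact: mulr0.
Qed.

Lemma tension_of_out f : f \in edges G :\: T -> weight f < tension_of T N f.
Proof.
move=> fT; have [m lead] := optN.1 f fT; have /setDP[_ fT'] := fT.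
rewrite /tension_of /fund_row (negPf fT'); apply: leads_dominates lead _ _ => //.
by case: FN => _ _ _ Nv b bT; apply: Nv.
Qed.

Lemma flow_of_out f : f \in edges G :\: T -> flow_of T N f = weight f.
Proof.
move=> fT; have /setDP[_ fT'] := fT.
rewrite /flow_of (big_setD1 f) //= /fund_col (negPf fT') eqxx mulr1.
rewrite big1 ?addr0 // => e; rewrite in_setD1 eq_sym => /andP[/negPf-> _].
exact: mulr0.
Qed.

Lemma flow_of_in f : f \in T -> f != p -> weight f < flow_of T N f.
Proof.
move=> fT fp; have [m lead] := optN.2 f fT fp.
rewrite /flow_of /fund_col fT; apply: leads_dominates lead _ _.
  by rewrite inE fT.
case: FN => _ _ _ Nv e eT; case: (Nv f e fT eT) => ->; rewrite ?oppr0 ?opprK;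
  by [constructor 1|constructor 2|constructor 3].
Qed.

Lemma tension_of_ge f : f \in edges G -> weight f <= tension_of T N f.
Proof.
move=> fG; case: (boolP (f \in T)) => fT; first by rewrite tension_of_in.
by rewrite ltW // tension_of_out // inE fT.
Qed.

Lemma flow_of_ge f : f \in edges G -> f != p -> weight f <= flow_of T N f.
Proof.
move=> fG fp; case: (boolP (f \in T)) => fT; first by rewrite ltW // flow_of_in.
by rewrite flow_of_out // inE fT.
Qed.

(** The value of [x] at [p] is free, which is why [pi] has to be constant along
    [p]. *)
Lemma positive_flow_diff0 (x : E -> int) (pi : V -> int) : flow G x ->
  {in edges G, forall f, f != p -> 0 < x f} -> diff G pi p = 0 ->
  {in edges G, forall f, 0 <= diff G pi f} ->
  {in edges G, forall f, diff G pi f = 0}.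
Proof.
move=> Fx pos diffp diff_ge0 f fG; have [->//|fp] := eqVneq f p.
have ge0 g : g \in edges G -> 0 <= x g * diff G pi g.
  move=> gG; have [->|gp] := eqVneq g p; first by rewrite diffp mulr0.
  by rewrite mulr_ge0 ?diff_ge0 // ltW // pos.
have /eqP := psumr_eq0P ge0 (Fx pi) fG.
by rewrite mulf_eq0 gt_eqF ?pos //= => /eqP.
Qed.

(** The positive tension of the tree is an increasing potential.  If no edge
    entered some [v] other than the tail of [p], the flow, positive off [p],
    could not be conserved at [v] unless [v] were isolated. *)
Lemma optimal_bipolar : connected_by G (edges G) -> bipolar_digraph G p.
Proof.
move=> cG; have /is_minP[pG _] := minp; have /andP[tpG hpG] := ends_in_verts pG.
have pos : {in edges G, forall f, f != p -> 0 < flow_of T N f}.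
  by move=> f fG fp; apply: lt_le_trans (weight_gt0 f) (flow_of_ge fG fp).
have nowhere v (c : int) u : v \in verts G -> c != 0 ->
    {in edges G, forall f, c * diff G (ind [set v]) f = 0} ->
    u \in verts G -> v == u.
  move=> vG c0 diff0 uG; rewrite eq_sym; apply/eqP/set1P.
  apply: (cG _ _ v) => // [f fG|]; last exact: set11.
  apply/eqP/diff_ind0/eqP; have /eqP := diff0 f fG.
  by rewrite mulf_eq0 (negPf c0).
have scale (c : int) v g :
    c * diff G (ind [set v]) g = diff G (fun u => c * ind [set v] u) g.
  by rewrite /diff; ring.
split=> //.
- have [pi Epi] := tension_ofP; exists pi => f fG.
  by rewrite -Epi //; apply: lt_le_trans (weight_gt0 f) (tension_of_ge fG).
- move=> v vG vp.
  case: (boolP [exists f in edges G, ehead G f == v]) => [/exists_inP[f fG /eqP]|].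
    by exists f.
  move=> /exists_inPn noin; case/negP: (vp); apply: (nowhere v (-1)) => // f fG.
  rewrite scale; apply: (positive_flow_diff0 flow_ofP pos) fG.
    rewrite -scale /diff /ind !inE (negPf (noin p pG)) (_ : _ == v = false) //.
    by rewrite eq_sym (negPf vp).
  move=> g gG; rewrite -scale /diff /ind !inE (negPf (noin g gG)).
  by case: (_ == _).
- move=> v vG vp.
  case: (boolP [exists f in edges G, etail G f == v]) => [/exists_inP[f fG /eqP]|].
    by exists f.
  move=> /exists_inPn noout; case/negP: (vp); apply: (nowhere v 1) => // f fG.
  rewrite scale; apply: (positive_flow_diff0 flow_ofP pos) fG.
    rewrite -scale /diff /ind !inE (negPf (noout p pG)) (_ : _ == v = false) //.
    by rewrite eq_sym (negPf vp).
  move=> g gG; rewrite -scale /diff /ind !inE (negPf (noout g gG)).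
  by case: (_ == _).
Qed.

End Certificate.

(** The complementary slackness pairing between the flow of one tree and the
    tension of another. *)
Definition slack T N T' N' : int := \sum_(f in edges G)
  (flow_of T N f - weight f) * (tension_of T' N' f - weight f).

(** Orthogonality of flows and tensions removes the only term in which the two
    trees interact. *)
Lemma slackE T N T' N' : fundamental G T N -> fundamental G T' N' ->
  slack T N T' N' = \sum_(f in edges G) weight f * weight f
    - \sum_(f in edges G) flow_of T N f * weight f
    - \sum_(f in edges G) weight f * tension_of T' N' f.
Proof.
move=> FN FN'; rewrite /slack -[LHS]subr0.
rewrite -[X in _ - X](flow_tension (flow_ofP FN) (tension_ofP FN')) -!sumrB.
by apply: eq_bigr => f _; ring.
Qed.

(** At [p] the flow may be below the weight, but the tension has no excess
    there. *)
Lemma slack_term_ge0 T N T' N' f :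
  fundamental G T N -> optimal_matrix (edges G) T p N ->
  fundamental G T' N' -> optimal_matrix (edges G) T' p N' -> f \in edges G ->
  0 <= (flow_of T N f - weight f) * (tension_of T' N' f - weight f).
Proof.
move=> FN optN FN' optN' fG; have [->|fp] := eqVneq f p.
  by rewrite (tension_of_in _ (min_in_tree FN' optN')) subrr mulr0.
by rewrite mulr_ge0 // subr_ge0 ?(flow_of_ge FN) // (tension_of_ge FN').
Qed.

(** The tension is tight on the tree and the flow is tight off it. *)
Lemma slack_diag T N : fundamental G T N -> optimal_matrix (edges G) T p N ->
  slack T N T N = 0.
Proof.
move=> FN optN; apply: big1 => f fG; case: (boolP (f \in T)) => fT.
  by rewrite tension_of_in // subrr mulr0.
by rewrite flow_of_out ?subrr ?mul0r // inE fT.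
Qed.

(** As the slack is a sum of two separate functions of the trees, the two mixed
    slacks add up to the two diagonal ones, that is to zero; an edge of [T]
    outside [T'] would make one of them positive. *)
Lemma optimal_sub T N T' N' :
  fundamental G T N -> optimal_matrix (edges G) T p N ->
  fundamental G T' N' -> optimal_matrix (edges G) T' p N' -> T \subset T'.
Proof.
move=> FN optN FN' optN'.
have ge0 := slack_term_ge0 FN optN FN' optN'.
have ge0' := slack_term_ge0 FN' optN' FN optN.
have slack0 : slack T N T' N' = 0.
  have : slack T N T' N' + slack T' N' T N = slack T N T N + slack T' N' T' N'.
    by rewrite !slackE //; ring.
  rewrite !slack_diag // addr0 => sum0; apply/eqP.
  have := sum0; move/eqP; rewrite paddr_eq0 => [/andP[]//||]; exact: sumr_ge0.
apply/subsetP => f fT; apply/negPn/negP => fT'.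
have fG := subsetP (fundamental_sub FN) f fT.
have fp : f != p by apply: contraNneq fT' => ->; apply: min_in_tree optN'.
have /eqP := psumr_eq0P ge0 slack0 fG.
by rewrite mulf_eq0 !subr_eq0 !gt_eqF ?(flow_of_in FN) ?(tension_of_out FN') // inE fT'.
Qed.

Lemma fully_optimal_spanning T : fully_optimal G T -> spanning_tree G T.
Proof. by case/and3P. Qed.

Lemma fully_optimal_matrix T : fully_optimal G T ->
  exists N, fundamental G T N /\ optimal_matrix (edges G) T p N.
Proof.
move=> optT; have tT := fully_optimal_spanning optT.
have [N FN] := spanning_fundamental tT.
by exists N; split=> //; apply/(fully_optimalP minp tT FN).
Qed.

Lemma fully_optimal_unique T T' :
  fully_optimal G T -> fully_optimal G T' -> T = T'.
Proof.
move=> /fully_optimal_matrix[N [FN optN]] /fully_optimal_matrix[N' [FN' optN']].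
by apply/eqP; rewrite eqEsubset (optimal_sub FN optN FN') // (optimal_sub FN' optN' FN).
Qed.

Lemma alpha_eq T : fully_optimal G T -> alpha G = T.
Proof.
rewrite /alpha => optT; case: pickP => [T' optT'|/(_ T)]; last by rewrite optT.
exact: fully_optimal_unique.
Qed.

Lemma fully_optimal_bipolar T : fully_optimal G T -> bipolar_digraph G p.
Proof.
move=> optT; have [N [FN optN]] := fully_optimal_matrix optT.
apply: optimal_bipolar FN optN _; have tT := fully_optimal_spanning optT.
exact: connected_byS (spanning_sub tT) (spanning_connected tT).
Qed.

End Certificates.

(** * Lifting optimal trees from the minors *)
Section Lifting.
Variables (G : digraph V E) (p w : E).
Hypotheses (minp : is_min (edges G) p) (maxw : is_max (edges G) w) (wp : w != p).

Lemma max_edge : w \in edges G. Proof. by case/is_maxP: maxw. Qed.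

Lemma min_minor : is_min (edges G :\ w) p.
Proof.
have /is_minP[pG lep] := minp; apply/is_minP; split; first by rewrite !inE eq_sym wp.
by move=> f /setD1P[_]; apply: lep.
Qed.

Lemma lt_max f : f \in edges G -> f != w -> (f < w)%O.
Proof. by case/is_maxP: maxw => _ lew fG fw; rewrite lt_neqAle fw lew. Qed.

(** An entry at the last edge never becomes the leading one. *)
Lemma leads_add_max (B : {set E}) (a : E -> int) m f : B \subset edges G ->
  leads (B :\ w) a m f -> leads B a m f.
Proof.
move=> sB [/setD1P[mw mB] mf am leg]; split=> // g gB ag.
have [->|gw] := eqVneq g w; first by rewrite ltW // lt_max // (subsetP sB).
by apply: leg; rewrite // !inE gw.
Qed.

Lemma optimal_matrix_deletion T N m : w \notin T -> leads T (N^~ w) m w ->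
  optimal_matrix (edges G :\ w) T p N -> optimal_matrix (edges G) T p N.
Proof.
move=> wT lead [opte optb]; split=> [e|b bT bp].
  have [->|ew] := eqVneq e w; first by exists m.
  by rewrite inE => /andP[eT eG]; apply: opte; rewrite !inE eT ew.
have [m' lead'] := optb b bT bp; exists m'.
apply: leads_add_max; first exact: subsetDl.
by rewrite setDDl setUC -setDDl in lead'.
Qed.

Lemma optimal_matrix_contraction T N m : T \subset edges G -> w \in T ->
  leads (edges G :\: T) (fun e => - N w e) m w ->
  optimal_matrix (edges G :\ w) (T :\ w) p N -> optimal_matrix (edges G) T p N.
Proof.
move=> sT wT lead [].
have -> : (edges G :\ w) :\: (T :\ w) = edges G :\: T.
  by apply/setP => f; rewrite !inE negb_and negbK; case: eqP => [->|]; rewrite //= wT.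
move=> opte optb; split=> [e eT|b bT bp].
  by have [m' lead'] := opte e eT; exists m'; apply: leads_add_max.
have [->|bw] := eqVneq b w; first by exists m.
by apply: optb; rewrite // !inE bw.
Qed.

(** The only condition that [T] does not inherit is that of the column of [w].
    Its leading entry exists because [w] is not a loop, and comes before [w]
    because [w] is last. *)
Lemma deletion_lift T : bipolar_digraph G p -> fully_optimal (deletion G w) T ->
  exists N m, [/\ w \in edges G :\: T, spanning_tree G T, fundamental G T N
    & leads T (N^~ w) m w /\ fully_optimal G T \/
      leads T (fun b => - N b w) m w /\ fully_optimal (reorient G w) T].
Proof.
move=> [_ [pi inc] _ _] optT; have wG := max_edge.
have nl := increasing_noloop inc wG.
have tT' := fully_optimal_spanning optT.
have := spanning_sub tT'; rewrite subsetD1 => /andP[sT wT].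
have wGT : w \in edges G :\: T by rewrite inE wT.
have tT := spanning_deletion tT'; have [N FN] := spanning_fundamental tT.
have opt' : optimal_matrix (edges G :\ w) T p N.
  have FN' := fundamental_deletion wG wT FN.
  exact/(fully_optimalP (G := deletion G w) min_minor tT' FN').
have [_ _ fc Nv] := FN.
have [|||m lead] := @leads_or _ _ T (N^~ w) w.
- by move=> g gT; apply: lt_max; [apply: (subsetP sT) | apply: contraNneq wT => <-].
- by move=> b bT; apply: Nv.
- case: (boolP [exists g in T, N g w != 0]) => [/exists_inP//|/exists_inPn N0].
  have := tension_off_tree FN (ind_tension G [set ehead G w]) wGT.
  rewrite big1 => [|b bT]; last by have /negPn/eqP-> := N0 b bT; rewrite mul0r.
  by rewrite /diff /ind !inE eqxx (negPf nl).
exists N, m; split; [exact: wGT | exact: tT | exact: FN |].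
case: lead => lead; [left | right]; (split; first exact: lead).
  by apply/(fully_optimalP minp tT FN); apply: optimal_matrix_deletion lead opt'.
apply/(fully_optimalP (G := reorient G w) minp
  (spanning_reorient w tT) (fundamental_reorient w FN)).
apply: optimal_matrix_deletion (wT) _ _.
  apply: eq_leads lead => b bT /=; rewrite /rsign eqxx.
  by rewrite (negPf (_ : b != w)) ?mul1r ?mulN1r //; apply: contraNneq wT => <-.
apply: eq_optimal_matrix opt' => b e bT; rewrite !inE => /and3P[_ ew _].
rewrite /rsign (negPf ew) (negPf (_ : b != w)) ?mul1r //.
by apply: contraNneq wT => <-.
Qed.

(** Dual to [deletion_lift]; that [w] is not an isthmus provides the leading
    entry of its row. *)
Lemma contraction_lift T : bipolar_digraph G p ->
  fully_optimal (contraction G w) T -> let T1 := w |: T in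
  exists N m, [/\ w \notin T, spanning_tree G T1, fundamental G T1 N
    & leads (edges G :\: T1) (fun e => - N w e) m w /\ fully_optimal G T1 \/
      leads (edges G :\: T1) (N w) m w /\ fully_optimal (reorient G w) T1].
Proof.
move=> bG optT T1; have wG := max_edge; have [_ [pi inc] _ _] := bG.
have nl := increasing_noloop inc wG.
have tT' := fully_optimal_spanning optT.
have := spanning_sub tT'; rewrite subsetD1 => /andP[sT wT].
have wT1 : w \in T1 by apply: setU11.
have tT := spanning_contraction wG nl tT'; have [N FN] := spanning_fundamental tT.
have ET : T1 :\ w = T by apply: setU1K.
have sT1 : T1 \subset edges G := spanning_sub tT.
have opt' : optimal_matrix (edges G :\ w) (T1 :\ w) p N.
  have := fundamental_contraction wG wT1 FN; rewrite ET => FN'.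
  exact/(fully_optimalP (G := contraction G w) min_minor tT' FN').
have [_ tr _ Nv] := FN.
have [|||m lead] := @leads_or _ _ (edges G :\: T1) (N w) w.
- move=> g /setDP[gG gT]; apply: lt_max => //; by apply: contraNneq gT => ->.
- by move=> e; apply: Nv.
- case: (boolP [exists g in edges G :\: T1, N w g != 0]) => [/exists_inP//|].
  move=> /exists_inPn N0; have [rho Erho] := tr w wT1.
  exfalso; apply: (bipolar_no_isthmus (pi := rho) bG wG wp) => f fG.
  rewrite -Erho // /fund_row; case: (boolP (f \in T1)) => // fT1.
  have /negPn/eqP-> : ~~ (N w f != 0) by apply: N0; rewrite inE fT1.
  by rewrite (negPf (_ : f != w)) //; apply: contraNneq fT1 => ->.
exists N, m; split; [exact: wT | exact: tT | exact: FN |].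
case: lead => lead; [right | left]; (split; first exact: lead); last first.
  by apply/(fully_optimalP minp tT FN); apply: optimal_matrix_contraction lead opt'.
apply/(fully_optimalP (G := reorient G w) minp
  (spanning_reorient w tT) (fundamental_reorient w FN)).
apply: optimal_matrix_contraction sT1 (wT1) _ _.
  apply: eq_leads lead => e /setDP[_ eT] /=; rewrite /rsign eqxx.
  rewrite (negPf (_ : e != w)) ?mulr1 ?mulN1r ?opprK //.
  by apply: contraNneq eT => ->.
apply: eq_optimal_matrix opt' => b e /setD1P[bw _]; rewrite !inE => /and3P[_ ew _].
by rewrite /rsign (negPf ew) (negPf bw) !mul1r.
Qed.

End Lifting.

(** * Existence and the inductive construction *)
Lemma max_exists G p : p \in edges G -> exists w, is_max (edges G) w.
Proof.
move=> pG; have [w wG maxw] := @arg_maxP _ _ _ p (mem (edges G)) id pG.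
by exists w; apply/is_maxP.
Qed.

Lemma single_edge_optimal G p : bipolar_digraph G p -> edges G = [set p] ->
  fully_optimal G [set p].
Proof.
move=> [pG [pi inc] inE' outE] EG; have minp : is_min (edges G) p.
  by apply/is_minP; split=> // x; rewrite EG inE => /eqP->.
have nl := increasing_noloop inc pG.
have cG : connected_by G [set p].
  move=> S /(_ p (set11 p)) Sp.
  have inS v : v \in verts G -> (v \in S) = (ehead G p \in S).
    move=> vG; have [->|vp] := eqVneq v (etail G p); first exact: Sp.
    by have [f] := inE' v vG vp; rewrite EG inE => /eqP-> ->.
  by move=> u v uG vG; rewrite !inS.
have FN : fundamental G [set p] (fun _ _ => 0).
  split; first by rewrite EG.
  - move=> b; rewrite inE => /eqP->; exists (ind [set ehead G p]) => f.
    by rewrite EG => /set1P->; rewrite /fund_row /diff /ind !inE !eqxx (negPf nl) subr0.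
  - by move=> e; rewrite EG setDv inE.
  - by move=> b e _; rewrite EG setDv inE.
have tT : spanning_tree G [set p] by apply: fundamental_spanning FN; rewrite EG.
apply/(fully_optimalP minp tT FN); split=> [e|b]; first by rewrite EG setDv inE.
by rewrite inE => ->.
Qed.

(** Lifting from a bipolar minor fails only if the lifted tree is optimal for
    the reversed edge [w], and then the other minor is bipolar as well.  When
    both minors are bipolar, the two lifts cannot both fail, since they differ at
    [w] and would be two optimal trees of the same digraph. *)
Lemma fully_optimal_exists G p : bipolar_digraph G p -> is_min (edges G) p ->
  exists T, fully_optimal G T.
Proof.
have [k] := ubnP #|edges G|; elim: k G => // k IHk G leGk bG minp.
have /is_minP[pG _] := minp; have [w maxw] := max_exists pG.
have /is_maxP[wG lew] := maxw; have /is_minP[_ lep] := minp.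
have [Ew|wp] := eqVneq w p.
  exists [set p]; apply: single_edge_optimal => //; apply/eqP.
  rewrite eqEsubset sub1set pG andbT; apply/subsetP => f fG.
  by rewrite inE eq_le lep // -Ew lew.
have ltk : (#|edges G :\ w| < k)%N by rewrite (cardsD1 w) wG in leGk.
have minp' := min_minor minp wp.
have lift_contraction : bipolar_digraph (contraction G w) p ->
    (exists T, fully_optimal G T) \/ bipolar_digraph (deletion G w) p.
  move=> bC; have [T optT] := IHk (contraction G w) ltk bC minp'.
  have [N [m [_ _ _ [[_ opt]|[_ opt]]]]] := contraction_lift minp maxw wp bG optT.
    by left; exists (w |: T).
  right; apply: bipolar_reorient_deletion => //.
  exact: (fully_optimal_bipolar (G := reorient G w) minp opt).
have lift_deletion : bipolar_digraph (deletion G w) p ->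
    (exists T, fully_optimal G T) \/ bipolar_digraph (contraction G w) p.
  move=> bD; have [T optT] := IHk (deletion G w) ltk bD minp'.
  have [N [m [_ _ _ [[_ opt]|[_ opt]]]]] := deletion_lift minp maxw wp bG optT.
    by left; exists T.
  right; apply: bipolar_reorient_contraction => //.
  exact: (fully_optimal_bipolar (G := reorient G w) minp opt).
suff [//|[bC bD]] : (exists T, fully_optimal G T) \/
    bipolar_digraph (contraction G w) p /\ bipolar_digraph (deletion G w) p.
  have [T' optT'] := IHk (deletion G w) ltk bD minp'.
  have [T'' optT''] := IHk (contraction G w) ltk bC minp'.
  have [N [m [/setDP[_ wT] _ _ [[_ opt]|[_ opt]]]]] :=
    deletion_lift minp maxw wp bG optT'.
    by exists T'.
  have [N' [m' [_ _ _ [[_ opt']|[_ opt']]]]] :=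
    contraction_lift minp maxw wp bG optT''.
    by exists (w |: T'').
  have := fully_optimal_unique (G := reorient G w) minp opt opt'.
  by move=> E'; rewrite E' setU11 in wT.
have [bC|bD] := bipolar_minor bG wG wp.
  by have [?|] := lift_contraction bC; [left | right].
by have [?|] := lift_deletion bD; [left | right].
Qed.

End Optimality.

Section Rules.
Variables (disp : Order.disp_t) (V : finType) (E : finOrderType disp).
Variables (G : digraph V E) (p w : E).
Hypotheses (minp : is_min (edges G) p) (maxw : is_max (edges G) w) (wp : w != p).
Hypothesis bG : bipolar_digraph G p.
Variables T' T'' : {set E}.
Hypotheses (optD : fully_optimal (deletion G w) T')
  (optC : fully_optimal (contraction G w) T'').

(** If the sign at [w] is wrong for the tree of the deletion, that tree is
    optimal for the reversed edge [w]; by uniqueness the tree lifted from the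
    contraction is not, so it is optimal in [G]. *)
Lemma cycle_rule : let C := fund_cycle G T' w in
  exists e, [/\ is_min C e,
    opposite_in_cycle G C e w (+) same_in_cycle G C e w,
    opposite_in_cycle G C e w -> alpha G = T'
  & same_in_cycle G C e w -> alpha G = T'' :|: [set w]].
Proof.
move=> C.
have [N [m [wT tT FN signs]]] := deletion_lift minp maxw wp bG optD.
have [N' [m' [_ _ _ signs']]] := contraction_lift minp maxw wp bG optC.
have [mT mw Nm leg] : [/\ m \in T', (m < w)%O, N m w != 0
    & forall g, g \in T' -> N g w != 0 -> (m <= g)%O].
  case: signs => -[[mT mw Nm leg] _]; split=> //; first by rewrite Nm.
    by rewrite -oppr_eq0 Nm.
  by move=> g gT Ng; apply: leg; rewrite ?oppr_eq0.
have /andP[minC m_w] : is_min C m && (m != w) by apply/(fund_cycle_min m tT FN wT).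
exists m; rewrite opposite_in_cycleC same_in_cycleC.
rewrite (opposite_fund_cycle tT FN wT) (same_fund_cycle tT FN wT) // mT /=.
case: signs => -[[_ _ Em _] opt].
  rewrite Em; split; [exact: minC | by [] | move=> _ | by []].
  exact: (alpha_eq minp opt).
have {}Em : N m w = -1 by rewrite -Em opprK.
rewrite Em; split; [exact: minC | by [] | by [] | move=> _].
case: signs' => -[_ opt']; first by rewrite setUC (alpha_eq minp opt').
have E' := fully_optimal_unique (G := reorient G w) minp opt opt'.
by move: wT; rewrite inE E' setU11.
Qed.

Lemma cocycle_rule : let D := fund_cocycle G (T'' :|: [set w]) w in
  exists e, [/\ is_min D e,
    opposite_in_cocycle G D e w (+) same_in_cocycle G D e w,
    opposite_in_cocycle G D e w -> alpha G = T'' :|: [set w]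
  & same_in_cocycle G D e w -> alpha G = T'].
Proof.
rewrite [T'' :|: _]setUC => D.
have [N' [m' [wT' _ _ signs']]] := deletion_lift minp maxw wp bG optD.
have [N [m [wT tT FN signs]]] := contraction_lift minp maxw wp bG optC.
have wT1 : w \in w |: T'' := setU11 w T''.
have [mT mw Nm leg] : [/\ m \in edges G :\: (w |: T''), (m < w)%O, N w m != 0
    & forall g, g \in edges G :\: (w |: T'') -> N w g != 0 -> (m <= g)%O].
  case: signs => -[[mT mw Nm leg] _]; split=> //; last by rewrite Nm.
    by rewrite -oppr_eq0 Nm.
  by move=> g gT Ng; apply: leg; rewrite ?oppr_eq0.
have /andP[minD m_w] : is_min D m && (m != w).
  by apply/(fund_cocycle_min m tT FN wT1).
exists m; rewrite opposite_in_cocycleC same_in_cocycleC.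
rewrite (opposite_fund_cocycle tT FN wT1) (same_fund_cocycle tT FN wT1) // mT /=.
case: signs => -[[_ _ Em _] opt].
  have {}Em : N w m = -1 by rewrite -Em opprK.
  rewrite Em; split; [exact: minD | by [] | move=> _ | by []].
  exact: (alpha_eq minp opt).
rewrite Em; split; [exact: minD | by [] | by [] | move=> _].
case: signs' => -[_ opt']; first exact: (alpha_eq minp opt').
have E' := fully_optimal_unique (G := reorient G w) minp opt' opt.
by move: wT'; rewrite inE E' setU11.
Qed.

End Rules.

Local Close Scope ring_scope.

Theorem theorem6p2 (disp : Order.disp_t) (V : finType) (E : finOrderType disp)
    (G : digraph V E) (p w : E)
    (bipG : bipolar G p) (minp : is_min (edges G) p)
    (maxw : is_max (edges G) w) :
  (#|edges G| = 1 -> alpha G = [set w]) /\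
  (1 < #|edges G| ->
    [/\ (* exhaustiveness of the cases *)
        bipolar (contraction G w) p || bipolar (deletion G w) p,
        (* (a) *)
        bipolar (contraction G w) p -> ~~ bipolar (deletion G w) p ->
          alpha G = alpha (contraction G w) :|: [set w],
        (* (b) *)
        bipolar (deletion G w) p -> ~~ bipolar (contraction G w) p ->
          alpha G = alpha (deletion G w),
        (* (c), by means of the fundamental cycle *)
        bipolar (deletion G w) p -> bipolar (contraction G w) p ->
          let T' := alpha (deletion G w) in
          let C := fund_cycle G T' w in
          exists e : E,
            [/\ is_min C e,
                opposite_in_cycle G C e w (+) same_in_cycle G C e w,
                opposite_in_cycle G C e w -> alpha G = alpha (deletion G w)
              & same_in_cycle G C e w ->
                  alpha G = alpha (contraction G w) :|: [set w]]
      & (* (c), by means of the fundamental cocycle *)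
        bipolar (deletion G w) p -> bipolar (contraction G w) p ->
          let T'' := alpha (contraction G w) in
          let D := fund_cocycle G (T'' :|: [set w]) w in
          exists e : E,
            [/\ is_min D e,
                opposite_in_cocycle G D e w (+) same_in_cocycle G D e w,
                opposite_in_cocycle G D e w ->
                  alpha G = alpha (contraction G w) :|: [set w]
              & same_in_cocycle G D e w -> alpha G = alpha (deletion G w)]]).
Proof.
have bG := (bipolarP G p).1 bipG; have /is_minP[pG lep] := minp.
have /is_maxP[wG lew] := maxw; split.
  move=> /eqP/cards1P[q Eq]; have := wG; have := pG; rewrite Eq !inE.
  move=> /eqP Ep /eqP Ew; apply: (alpha_eq minp).
  by rewrite Ew -Ep; apply: single_edge_optimal => //; rewrite Eq Ep.
move=> gt1; have wp : w != p.
  apply: contraTneq gt1 => Ew; rewrite -leqNgt -(cards1 p) subset_leq_card //.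
  by apply/subsetP => f fG; rewrite inE eq_le lep // -Ew lew.
have minp' := min_minor minp wp.
have alphaD : bipolar (deletion G w) p ->
    fully_optimal (deletion G w) (alpha (deletion G w)).
  move=> /bipolarP bD; have [T optT] := fully_optimal_exists bD minp'.
  by rewrite (alpha_eq (G := deletion G w) minp' optT).
have alphaC : bipolar (contraction G w) p ->
    fully_optimal (contraction G w) (alpha (contraction G w)).
  move=> /bipolarP bC; have [T optT] := fully_optimal_exists bC minp'.
  by rewrite (alpha_eq (G := contraction G w) minp' optT).
split.
- apply/orP; have [/bipolarP|/bipolarP] := bipolar_minor bG wG wp; by [left | right].
- move=> /alphaC optC nD.
  have [N [m [_ _ _ [[_ opt]|[_ opt]]]]] := contraction_lift minp maxw wp bG optC.
    by rewrite setUC; apply: (alpha_eq minp).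
  case/negP: nD; apply/bipolarP; apply: bipolar_reorient_deletion => //.
  exact: (fully_optimal_bipolar (G := reorient G w) minp opt).
- move=> /alphaD optD nC.
  have [N [m [_ _ _ [[_ opt]|[_ opt]]]]] := deletion_lift minp maxw wp bG optD.
    exact: (alpha_eq minp).
  case/negP: nC; apply/bipolarP; apply: bipolar_reorient_contraction => //.
  exact: (fully_optimal_bipolar (G := reorient G w) minp opt).
- move=> /alphaD optD /alphaC optC T' C.
  exact: (cycle_rule minp maxw wp bG optD optC).
- move=> /alphaD optD /alphaC optC T'' D.
  exact: (cocycle_rule minp maxw wp bG optD optC).
Qed.
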